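(* Let $\Lambda$ be a row-finite $k$-graph with no sources and let $\beta\in\operatorname{Aut}(\Lambda)$. Suppose that $\psi\in Z^2(\Lambda,\mathbb{T})$ is such that $[\psi]\in\ker(1-\beta^* )$, where $1-\beta^*:H^2(\Lambda,\mathbb{T})\to H^2(\Lambda,\mathbb{T})$. Then there is $\varphi\in Z^2(\Lambda\times_\beta\mathbb{Z},\mathbb{T})$ such that $\psi=i^*(\varphi)$. In particular there is an automorphism $\beta_\varphi$ of $C^*_\psi(\Lambda)$, satisfying $$\beta_\varphi(p_v)=p_{\beta v}\quad\text{and}\quad\beta_\varphi(s_e)=\varphi(\beta e,1)s_{\beta e}\quad\text{for all } v\in Q_0(\Lambda)\text{ and } e\in Q_1(\Lambda),$$ such that $$C^*_{i^*(\varphi)}(\Lambda)\rtimes_{\beta_\varphi}\mathbb{Z}\cong C^*_\varphi(\Lambda\times_\beta\mathbb{Z}).$$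
   Context: $k$-graphs. A $k$-graph is a nonempty countable small category $\Lambda$ with a functor $d:\Lambda\to\mathbb{N}^k$ ($0\in\mathbb{N}$) such that whenever $d(\lambda)=m+n$ there are unique $\mu,\nu\in\Lambda$ with $d(\mu)=m$, $d(\nu)=n$, $\lambda=\mu\nu$. $\Lambda^n:=d^{-1}(n)$; $\Lambda^0$ is identified with the objects; $r,s:\Lambda\to\Lambda^0$ are the codomain and domain maps; $v\Lambda^n=\{\lambda\in\Lambda^n:r(\lambda)=v\}$. $\Lambda$ is row-finite with no sources if $0<|v\Lambda^n|<\infty$ for all $v\in\Lambda^0$, $n\in\mathbb{N}^k$. $e_1,\dots,e_k$ are the standard generators of $\mathbb{N}^k$. $\operatorname{Aut}(\Lambda)$ is the group of invertible degree-preserving functors $\Lambda\to\Lambda$. Cubes and cohomology. With $|n|=\sum_i n_i$ and $\mathbf{1}_k=\sum_i e_i$, $Q_r(\Lambda)=\{\lambda\in\Lambda:d(\lambda)\le\mathbf{1}_k,\ |d(\lambda)|=r\}$; so $Q_0(\Lambda)=\Lambda^0$ and $Q_1(\Lambda)=\bigcup_i\Lambda^{e_i}$. For $\lambda\in Q_r(\Lambda)$ with $d(\lambda)=e_{i_1}+\dots+e_{i_r}$, $i_1<\dots<i_r$, and $1\le j\le r$, $F_j^0(\lambda),F_j^1(\lambda)\in Q_{r-1}(\Lambda)$ are the unique elements for which there exist $\mu,\nu\in\Lambda^{e_{i_j}}$ with $F_j^0(\lambda)\nu=\lambda=\mu F_j^1(\lambda)$. For an abelian group $A$ (additive notation), $C^r(\Lambda,A)$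 is the group of functions $Q_r(\Lambda)\to A$, $\delta^r(f)(\lambda)=\sum_{j=1}^{r+1}\sum_{\ell=0}^1(-1)^{j+\ell}f(F_j^\ell(\lambda))$ for $\lambda\in Q_{r+1}(\Lambda)$, $Z^r(\Lambda,A)=\ker\delta^r$ and $H^r(\Lambda,A)=\ker\delta^r/\operatorname{Im}\delta^{r-1}$. The map $\beta^*(f)=f\circ\beta$ on cochains commutes with $\delta^*$ and induces $\beta^*:H^r(\Lambda,A)\to H^r(\Lambda,A)$. For $A=\mathbb{T}$ (unit circle) multiplicative notation is used for cocycles (so $[\psi]\in\ker(1-\beta^* )$ means $[\psi]=[\beta^*\psi]$). Crossed product graph. $\Lambda\times_\beta\mathbb{Z}$ is the (row-finite, no sources) $(k+1)$-graph with morphisms $\Lambda\times\mathbb{N}$, $r(\lambda,n)=(r(\lambda),0)$, $s(\lambda,n)=(\beta^{-n}(s(\lambda)),0)$, $d(\lambda,n)=(d(\lambda),n)$, composition $(\lambda,m)(\mu,n)=(\lambda\beta^m(\mu),m+n)$. Its cubes are $Q_0=Q_0(\Lambda)\times\{0\}$ and $Q_{r+1}(\Lambda\times_\beta\mathbb{Z})=\{(\lambda,1):\lambda\in Q_r(\Lambda)\}\cup\{(\lambda,0):\lambda\in Q_{r+1}(\Lambda)\}$. For $\varphi\in Z^2(\Lambda\times_\beta\mathbb{Z},\mathbb{T})$, $i^*(\varphi)\in Z^2(\Lambda,\mathbb{T})$ is $i^*(\varphi)(\lambda)=\varphi(\lambda,0)$. Twisted algebras. For a row-finite $k$-graph $\Lambda$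 with no sources and $\varphi\in Z^2(\Lambda,\mathbb{T})$, a Cuntz–Krieger $\varphi$-representation of $\Lambda$ in a $C^*$-algebra $A$ consists of mutually orthogonal projections $\{p_v:v\in\Lambda^0\}\subseteq A$ and elements $\{s_\lambda:\lambda\in Q_1(\Lambda)\}\subseteq A$ such that: (TG1) $s_\lambda^*s_\lambda=p_{s(\lambda)}$ for all $1\le i\le k$, $\lambda\in\Lambda^{e_i}$; (TG2) for $1\le i<j\le k$ and $\mu,\mu'\in\Lambda^{e_i}$, $\nu,\nu'\in\Lambda^{e_j}$ with $\mu\nu=\nu'\mu'$, $s_{\nu'}s_{\mu'}=\varphi(\mu\nu)s_\mu s_\nu$; (TG3) $p_v=\sum_{\lambda\in v\Lambda^{e_i}}s_\lambda s_\lambda^*$ for all $v\in\Lambda^0$ and $i$ with $v\Lambda^{e_i}\neq\emptyset$. $C^*_\varphi(\Lambda)$ is the universal $C^*$-algebra generated by a Cuntz–Krieger $\varphi$-representation, with universal generators $p_v,s_\lambda$. *)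

(* Defs.v *)
From HB Require Import structures.
From mathcomp Require Import all_boot all_order all_algebra complex.
From mathcomp Require Import all_classical all_reals all_analysis.
Import numFieldNormedType.Exports.

Set Implicit Arguments.
Unset Strict Implicit.
Unset Printing Implicit Defensive.

Import Order.TTheory GRing.Theory Num.Theory.
Local Open Scope classical_set_scope.
Local Open Scope ring_scope.
Local Open Scope complex_scope.

Reserved Notation "x ** y" (at level 40, left associativity).

(* Arrows-only presentation: an object is identified with its identity
   morphism, so [rng] and [src] are endomaps.  [kcomp f g] is only meaningful
   when [src f = rng g].  That identities are exactly the morphisms of degree 0
   follows from [deg_comp] and [factorization]. *)
Record kgraph (k : nat) := KGraph {
  mor :> countType;
  rng : mor -> mor;
  src : mor -> mor;
  kcomp : mor -> mor -> mor;
  deg : mor -> {ffun 'I_k -> nat};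
  mor_inhabited : inhabited mor;
  rng_rng : forall f, rng (rng f) = rng f;
  src_rng : forall f, src (rng f) = rng f;
  rng_src : forall f, rng (src f) = src f;
  src_src : forall f, src (src f) = src f;
  rng_comp : forall f g, src f = rng g -> rng (kcomp f g) = rng f;
  src_comp : forall f g, src f = rng g -> src (kcomp f g) = src g;
  comp_rng : forall f, kcomp (rng f) f = f;
  comp_src : forall f, kcomp f (src f) = f;
  compA : forall f g h, src f = rng g -> src g = rng h ->
    kcomp f (kcomp g h) = kcomp (kcomp f g) h;
  deg_comp : forall f g, src f = rng g -> deg (kcomp f g) = deg f + deg g;
  factorization : forall (f : mor) (m n : {ffun 'I_k -> nat}),
    deg f = m + n ->
    exists! p : mor * mor,
      [/\ src p.1 = rng p.2, deg p.1 = m, deg p.2 = n & kcomp p.1 p.2 = f]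
}.

Lemma deg_rng k (L : kgraph k) (f : L) : deg (rng f) = 0.
Proof.
have /deg_comp : src (rng f) = rng f by rewrite src_rng.
rewrite comp_rng => /ffunP e; apply/ffunP => i; have := e i.
by rewrite !ffunE => /eqP; rewrite -{1}[deg f i]add0n eqn_add2r => /eqP <-.
Qed.

Lemma deg_src k (L : kgraph k) (f : L) : deg (src f) = 0.
Proof. by rewrite -rng_src deg_rng. Qed.

Definition basis_deg k (i : 'I_k) : {ffun 'I_k -> nat} :=
  [ffun j => nat_of_bool (j == i)].

Definition row_finite_no_sources k (L : kgraph k) : Prop :=
  forall (v : L) (n : {ffun 'I_k -> nat}), deg v = 0 ->
    let vLn := [set f : L | rng f = v /\ deg f = n] in
    finite_set vLn /\ vLn !=set0.

Record kaut k (L : kgraph k) := KAut {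
  kaut_fun :> L -> L;
  kaut_inv : L -> L;
  kaut_funK : cancel kaut_fun kaut_inv;
  kaut_invK : cancel kaut_inv kaut_fun;
  kaut_rng : forall f, rng (kaut_fun f) = kaut_fun (rng f);
  kaut_src : forall f, src (kaut_fun f) = kaut_fun (src f);
  kaut_comp : forall f g, src f = rng g ->
    kaut_fun (kcomp f g) = kcomp (kaut_fun f) (kaut_fun g);
  kaut_deg : forall f, deg (kaut_fun f) = deg f
}.

Definition is_cube k (L : kgraph k) (r : nat) (f : L) : bool :=
  [forall i, deg f i <= 1]%N && (\sum_i deg f i == r)%N.

Definition Q k (L : kgraph k) (r : nat) := {f : L | is_cube r f}.

Fact is_cube_rng k (L : kgraph k) (f : L) : is_cube 0 (rng f).
Proof.
rewrite /is_cube deg_rng; apply/andP; split; first by apply/forallP => i; rewrite ffunE.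
by rewrite big1 // => i _; rewrite ffunE.
Qed.

Fact is_cube_src k (L : kgraph k) (f : L) : is_cube 0 (src f).
Proof. by rewrite -rng_src is_cube_rng. Qed.

Definition vrng k (L : kgraph k) (f : L) : Q L 0 := exist _ (rng f) (is_cube_rng f).
Definition vsrc k (L : kgraph k) (f : L) : Q L 0 := exist _ (src f) (is_cube_src f).

(* The directions [i_1 < ... < i_r] of an r-cube, 0-based. *)
Fact size_dirs k (L : kgraph k) r (q : Q L r) :
  size [seq i <- enum 'I_k | deg (val q) i == 1%N] == r.
Proof.
case: q => f /= /andP[/forallP f1 /eqP <-].
rewrite size_filter -sum1_count big_enum_cond /= big_mkcond /=.
apply/eqP/eq_bigr => i _; move: (f1 i).
by case: (deg f i) => [|[|?]].
Qed.

Definition dirs k (L : kgraph k) r (q : Q L r) : r.-tuple 'I_k :=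
  Tuple (size_dirs q).

(* [is_face j l q g]: g is the face F_{j+1}^l(q), where l = false (resp. true)
   stands for 0 (resp. 1). *)
Definition is_face k (L : kgraph k) r (q : Q L r.+1) (j : 'I_r.+1) (l : bool)
    (g : Q L r) : Prop :=
  exists2 h : L, deg h = basis_deg (tnth (dirs q) j) &
    if l then src h = rng (val g) /\ kcomp h (val g) = val q
    else src (val g) = rng h /\ kcomp (val g) h = val q.

Fact face_exists k (L : kgraph k) r (q : Q L r.+1) (j : 'I_r.+1) (l : bool) :
  exists g : Q L r, is_face q j l g.
Proof.
set i := tnth (dirs q) j.
have qi : deg (val q) i = 1%N.
  have : i \in [seq i <- enum 'I_k | deg (val q) i == 1%N] := mem_tnth j (dirs q).
  by rewrite mem_filter => /andP[/eqP].
pose m : {ffun 'I_k -> nat} := [ffun a => (deg (val q) a - basis_deg i a)%N].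
have qE : deg (val q) = m + basis_deg i.
  apply/ffunP => a; rewrite !ffunE; apply/esym/subnK.
  by have [->|//] := eqVneq a i; rewrite qi.
have /andP[/forallP q1 /eqP qr] := valP q.
have cm g : deg g = m -> is_cube r g.
  move=> gm; rewrite /is_cube gm; apply/andP; split.
    by apply/forallP => a; rewrite ffunE; apply: leq_trans (q1 a); exact: leq_subr.
  rewrite -(eqn_add2r 1) [X in _ == X]addn1 -qr qE; apply/eqP.
  under [RHS]eq_bigr do rewrite ffunE.
  rewrite big_split /=; congr addn.
  under eq_bigr do rewrite ffunE.
  by rewrite (bigD1 i)//= eqxx big1 ?addn0// => a /negPf ->.
case: l.
  have [] := factorization (etrans qE (addrC _ _)).
  move=> [h g] /= [[hg dh /cm cg hgq] _].
  by exists (exist _ g cg); exists h.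
have [] := factorization qE.
move=> [g h] /= [[gh /cm cg dh ghq] _].
by exists (exist _ g cg); exists h.
Qed.

Definition face k (L : kgraph k) r (j : 'I_r.+1) (l : bool) (q : Q L r.+1) : Q L r :=
  projT1 (cid (face_exists q j l)).

Definition cochain k (L : kgraph k) (r : nat) (A : zmodType) := Q L r -> A.

(* The sign exponent is [j + l] with the 1-based index [j], hence [j.+1]. *)
Definition delta k (L : kgraph k) r (A : zmodType) (f : cochain L r A) :
    cochain L r.+1 A :=
  fun q => \sum_(j < r.+1) \sum_(l : bool) f (face j l q) *~ ((-1) ^+ (j.+1 + l)).

Definition cocycle k (L : kgraph k) r (A : zmodType) (f : cochain L r A) : Prop :=
  forall q, delta f q = 0.

Definition coboundary k (L : kgraph k) r (A : zmodType) : cochain L r A -> Prop :=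
  match r with
  | 0 => fun f => forall q, f q = 0
  | r'.+1 => fun f => exists c : cochain L r' A, f = delta c
  end.

(* The class of a cocycle in H^r = Z^r / B^r, as a coset of B^r. *)
Definition cohomology_class k (L : kgraph k) r (A : zmodType) (f : cochain L r A) :
    set (cochain L r A) :=
  [set g | cocycle g /\ coboundary (fun q => g q - f q)].

Fact is_cube_aut k (L : kgraph k) (b : kaut L) r (q : Q L r) : is_cube r (b (val q)).
Proof. by rewrite /is_cube kaut_deg; exact: (valP q). Qed.

Definition cube_aut k (L : kgraph k) (b : kaut L) r (q : Q L r) : Q L r :=
  exist _ (b (val q)) (is_cube_aut b q).

Definition pullback k (L : kgraph k) (b : kaut L) r (A : zmodType)
    (f : cochain L r A) : cochain L r A :=
  fun q => f (cube_aut b q).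

Definition cp_deg k (m : {ffun 'I_k -> nat}) (n : nat) : {ffun 'I_k.+1 -> nat} :=
  [ffun i => if unlift ord_max i is Some j then m j else n].

Section CrossedProductGraph.
Variables (k : nat) (L : kgraph k) (b : kaut L).

Definition cp_mor : countType := (mor L * nat)%type.
Definition cp_rng (x : cp_mor) : cp_mor := (rng x.1, 0%N).
Definition cp_src (x : cp_mor) : cp_mor := (iter x.2 (kaut_inv b) (src x.1), 0%N).
Definition cp_comp (x y : cp_mor) : cp_mor := (kcomp x.1 (iter x.2 b y.1), (x.2 + y.2)%N).
Definition cp_degree (x : cp_mor) := cp_deg (deg x.1) x.2.

Fact kinv_rng f : rng (kaut_inv b f) = kaut_inv b (rng f).
Proof. by rewrite -{2}[f](kaut_invK b) kaut_rng kaut_funK. Qed.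
Fact kinv_src f : src (kaut_inv b f) = kaut_inv b (src f).
Proof. by rewrite -{2}[f](kaut_invK b) kaut_src kaut_funK. Qed.
Fact kiinv_rng n f : rng (iter n (kaut_inv b) f) = iter n (kaut_inv b) (rng f).
Proof. by elim: n => //= n <-; rewrite kinv_rng. Qed.
Fact kiinv_src n f : src (iter n (kaut_inv b) f) = iter n (kaut_inv b) (src f).
Proof. by elim: n => //= n <-; rewrite kinv_src. Qed.
Fact iaut_rng n f : rng (iter n b f) = iter n b (rng f).
Proof. by elim: n => //= n <-; rewrite kaut_rng. Qed.
Fact iaut_src n f : src (iter n b f) = iter n b (src f).
Proof. by elim: n => //= n <-; rewrite kaut_src. Qed.
Fact iautK n : cancel (iter n b) (iter n (kaut_inv b)).
Proof. by move=> f; elim: n f => //= n IH f; rewrite -iterS iterSr kaut_funK IH. Qed.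
Fact kiinvK n : cancel (iter n (kaut_inv b)) (iter n b).
Proof. by move=> f; elim: n f => //= n IH f; rewrite -iterS iterSr kaut_invK IH. Qed.
Fact iaut_comp n f g : src f = rng g ->
  iter n b (kcomp f g) = kcomp (iter n b f) (iter n b g).
Proof.
by move=> fg; elim: n => //= n ->; rewrite kaut_comp// iaut_src iaut_rng fg.
Qed.
Fact iaut_deg n f : deg (iter n b f) = deg f.
Proof. by elim: n => //= n <-; rewrite kaut_deg. Qed.

Fact cp_composable x y : cp_src x = cp_rng y <-> src x.1 = rng (iter x.2 b y.1).
Proof.
rewrite /cp_src /cp_rng iaut_rng; split=> [[<-]|->]; first by rewrite kiinvK.
by rewrite iautK.
Qed.

Fact cp_rng_rng x : cp_rng (cp_rng x) = cp_rng x.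
Proof. by rewrite /cp_rng rng_rng. Qed.
Fact cp_src_rng x : cp_src (cp_rng x) = cp_rng x.
Proof. by rewrite /cp_rng /cp_src /= src_rng. Qed.
Fact cp_rng_src x : cp_rng (cp_src x) = cp_src x.
Proof. by rewrite /cp_rng /cp_src /= kiinv_rng rng_src. Qed.
Fact cp_src_src x : cp_src (cp_src x) = cp_src x.
Proof. by rewrite /cp_src /= kiinv_src src_src. Qed.
Fact cp_rng_comp x y : cp_src x = cp_rng y -> cp_rng (cp_comp x y) = cp_rng x.
Proof. by move=> /cp_composable xy; rewrite /cp_rng rng_comp. Qed.
Fact cp_src_comp x y : cp_src x = cp_rng y -> cp_src (cp_comp x y) = cp_src y.
Proof.
by move=> /cp_composable xy; rewrite /cp_src src_comp//= iaut_src addnC iterD iautK.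
Qed.
Fact cp_comp_rng x : cp_comp (cp_rng x) x = x.
Proof. by case: x => f n; rewrite /cp_comp /cp_rng /= comp_rng. Qed.
Fact cp_comp_src x : cp_comp x (cp_src x) = x.
Proof. by case: x => f n; rewrite /cp_comp /cp_src /= kiinvK comp_src addn0. Qed.
Fact cp_compA x y z : cp_src x = cp_rng y -> cp_src y = cp_rng z ->
  cp_comp x (cp_comp y z) = cp_comp (cp_comp x y) z.
Proof.
move=> /cp_composable xy /cp_composable yz.
rewrite /cp_comp /= addnA iaut_comp// compA//; first by rewrite iterD.
by rewrite iaut_src yz -iaut_rng.
Qed.
Fact cp_deg_comp x y : cp_src x = cp_rng y ->
  cp_degree (cp_comp x y) = cp_degree x + cp_degree y.
Proof.
move=> /cp_composable xy; apply/ffunP => i; rewrite !ffunE deg_comp//.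
by case: unliftP => [j _|_]//; rewrite ffunE iaut_deg.
Qed.
Fact cp_degree_eq f n (m : {ffun 'I_k.+1 -> nat}) :
  cp_degree (f, n) = m <-> deg f = [ffun i => m (lift ord_max i)] /\ n = m ord_max.
Proof.
split=> [<-|[fE ->]].
  split; last by rewrite ffunE unlift_none.
  by apply/ffunP => i; rewrite !ffunE liftK.
apply/ffunP => i; rewrite ffunE /= fE.
by case: unliftP => [j ->|->]//; rewrite ffunE.
Qed.
Fact cp_factorization (f : cp_mor) (m n : {ffun 'I_k.+1 -> nat}) :
  cp_degree f = m + n ->
  exists! p : cp_mor * cp_mor,
    [/\ cp_src p.1 = cp_rng p.2, cp_degree p.1 = m, cp_degree p.2 = n
      & cp_comp p.1 p.2 = f].
Proof.
case: f => f a /cp_degree_eq[fE aE].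
pose m' : {ffun 'I_k -> nat} := [ffun i => m (lift ord_max i)].
pose n' : {ffun 'I_k -> nat} := [ffun i => n (lift ord_max i)].
have {}fE : deg f = m' + n' by rewrite fE; apply/ffunP => i; rewrite !ffunE.
have [[g h] /= [[gh gm hn ghf] uniq_gh]] := factorization fE.
exists ((g, m ord_max), (iter (m ord_max) (kaut_inv b) h, n ord_max)); split.
  split=> /=; first by apply/cp_composable; rewrite /= kiinvK.
  - exact/cp_degree_eq.
  - by apply/cp_degree_eq; split=> //; rewrite -(iaut_deg (m ord_max)) kiinvK.
  - by rewrite /cp_comp /= kiinvK ghf aE ffunE.
move=> [[g' a1] [h' a2]] /= [/cp_composable /= gh' /cp_degree_eq[gm' a1E]
  /cp_degree_eq[hn' a2E] [ghf' aE']].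
have /uniq_gh[-> ->] : [/\ src (g', iter a1 b h').1 = rng (g', iter a1 b h').2,
    deg g' = m', deg (iter a1 b h') = n' & kcomp g' (iter a1 b h') = f].
  by split=> //; rewrite iaut_deg.
by rewrite -a1E iautK -a2E.
Qed.
Fact cp_inhabited : inhabited cp_mor.
Proof. by case: (mor_inhabited L) => f; exists; exact: (f, 0%N). Qed.

Definition cpgraph : kgraph k.+1 := @KGraph k.+1 cp_mor cp_rng cp_src cp_comp
  cp_degree cp_inhabited cp_rng_rng cp_src_rng cp_rng_src cp_src_src cp_rng_comp
  cp_src_comp cp_comp_rng cp_comp_src cp_compA cp_deg_comp cp_factorization.

Fact is_cube_cp r (f : L) (n : nat) : (n <= 1)%N ->
  is_cube r f -> is_cube (r + n)%N ((f, n) : cpgraph).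
Proof.
move=> n1 /andP[/forallP f1 /eqP fr]; apply/andP; split.
  by apply/forallP => i; rewrite /= ffunE /=; case: unliftP.
rewrite big_ord_recr /= ffunE unlift_none /= -fr eqn_add2r.
apply/eqP/eq_bigr => i _; rewrite ffunE /=.
suff -> : widen_ord (leqnSn k) i = lift ord_max i by rewrite liftK.
by apply: val_inj; exact/esym/lift_max.
Qed.

Fact is_cube_base r (q : Q L r) : is_cube r ((val q, 0%N) : cpgraph).
Proof. by have := is_cube_cp (isT : (0 <= 1)%N) (valP q); rewrite addn0. Qed.

Fact is_cube_prism r (q : Q L r) : is_cube r.+1 ((val q, 1%N) : cpgraph).
Proof. by have := is_cube_cp (isT : (1 <= 1)%N) (valP q); rewrite addn1. Qed.

Definition base_cube r (q : Q L r) : Q cpgraph r :=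
  exist (@is_cube _ cpgraph r) (val q, 0%N) (is_cube_base q).
Definition prism_cube r (q : Q L r) : Q cpgraph r.+1 :=
  exist (@is_cube _ cpgraph r.+1) (val q, 1%N) (is_cube_prism q).

(* i^* *)
Definition base_restriction r (A : zmodType) (f : cochain cpgraph r A) : cochain L r A :=
  fun q => f (base_cube q).

End CrossedProductGraph.

Definition circle (R : realType) := {z : R[i] | `|z| == 1}.
HB.instance Definition _ (R : realType) := Choice.on (circle R).

Section Circle.
Variable R : realType.
Implicit Types z w : circle R.

Fact circle_mul_subproof z w : `|val z * val w| == 1.
Proof. by rewrite normrM (eqP (valP z)) (eqP (valP w)) mulr1. Qed.
Fact circle_inv_subproof z : `|(val z)^-1| == 1.
Proof. by rewrite normfV (eqP (valP z)) invr1. Qed.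
Fact circle_one_subproof : `|1 : R[i]| == 1.
Proof. by rewrite normr1. Qed.

Definition circle_mul z w : circle R :=
  exist (fun u : R[i] => `|u| == 1) _ (circle_mul_subproof z w).
Definition circle_inv z : circle R :=
  exist (fun u : R[i] => `|u| == 1) _ (circle_inv_subproof z).
Definition circle_one : circle R :=
  exist (fun u : R[i] => `|u| == 1) _ circle_one_subproof.

Fact circle_mulA : associative circle_mul.
Proof. by move=> x y z; apply: val_inj; rewrite /= mulrA. Qed.
Fact circle_mulC : commutative circle_mul.
Proof. by move=> x y; apply: val_inj; rewrite /= mulrC. Qed.
Fact circle_mul1 : left_id circle_one circle_mul.
Proof. by move=> x; apply: val_inj; rewrite /= mul1r. Qed.
Fact circle_mulV : left_inverse circle_one circle_inv circle_mul.
Proof.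
move=> x; apply: val_inj; rewrite /= mulVf// -normr_eq0 (eqP (valP x)).
exact: oner_neq0.
Qed.

(* T is written additively as a coefficient group: its [+%R] is the
   multiplication of complex numbers. *)
HB.instance Definition _ := GRing.isZmodule.Build (circle R)
  circle_mulA circle_mulC circle_mul1 circle_mulV.

End Circle.

HB.mixin Record isCStarAlgebra (R : realType) A of CompleteNormedModule (R[i]) A := {
  cmul : A -> A -> A;
  cstar : A -> A;
  cmulA : associative cmul;
  cmulDl : left_distributive cmul +%R;
  cmulDr : right_distributive cmul +%R;
  cmulZl : forall (a : R[i]) (x y : A), cmul (a *: x) y = a *: cmul x y;
  cmulZr : forall (a : R[i]) (x y : A), cmul x (a *: y) = a *: cmul x y;
  cstarK : involutive cstar;
  cstarD : forall x y, cstar (x + y) = cstar x + cstar y;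
  cstarZ : forall (a : R[i]) (x : A), cstar (a *: x) = (a^*)%R *: cstar x;
  cstarM : forall x y, cstar (cmul x y) = cmul (cstar y) (cstar x);
  cnorm_mul : forall x y, `|cmul x y| <= `|x| * `|y|;
  cnorm_star : forall x, `|cmul (cstar x) x| = `|x| ^+ 2
}.

#[short(type="cstarAlgType")]
HB.structure Definition CStarAlgebra (R : realType) :=
  {A of CompleteNormedModule (R[i]) A & isCStarAlgebra R A}.

Notation "x ** y" := (cmul x y) : ring_scope.

Record star_hom (R : realType) (A B : cstarAlgType R) (f : A -> B) : Prop := StarHom {
  star_hom_lin : forall (a : R[i]) x y, f (a *: x + y) = a *: f x + f y;
  star_hom_mul : forall x y, f (x ** y) = f x ** f y;
  star_hom_star : forall x, f (cstar x) = cstar (f x)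
}.

Definition cstar_isomorphic (R : realType) (A B : cstarAlgType R) : Prop :=
  exists2 f : A -> B, star_hom f & bijective f.

Record star_aut (R : realType) (A : cstarAlgType R) := StarAut {
  star_aut_fun :> A -> A;
  star_aut_inv : A -> A;
  star_aut_hom : star_hom star_aut_fun;
  star_aut_funK : cancel star_aut_fun star_aut_inv;
  star_aut_invK : cancel star_aut_inv star_aut_fun
}.

Definition closed_star_subalgebra (R : realType) (A : cstarAlgType R) (S : set A) : Prop :=
  [/\ closed S, S 0,
      (forall (a : R[i]) x y, S x -> S y -> S (a *: x + y)),
      (forall x y, S x -> S y -> S (x ** y))
    & (forall x, S x -> S (cstar x))].

Record ck_rep (R : realType) k (L : kgraph k) (phi : cochain L 2 (circle R))
    (A : cstarAlgType R) (p : Q L 0 -> A) (s : Q L 1 -> A) : Prop := CKRep {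
  ck_proj : forall v, p v ** p v = p v /\ cstar (p v) = p v;
  ck_orth : forall v w, v <> w -> p v ** p w = 0;
  ck_TG1 : forall e, cstar (s e) ** s e = p (vsrc (val e));
  ck_TG2 : forall (i j : 'I_k) (mu mu' nu nu' : Q L 1) (q : Q L 2), (i < j)%N ->
    deg (val mu) = basis_deg i -> deg (val mu') = basis_deg i ->
    deg (val nu) = basis_deg j -> deg (val nu') = basis_deg j ->
    src (val mu) = rng (val nu) -> src (val nu') = rng (val mu') ->
    kcomp (val mu) (val nu) = val q -> kcomp (val nu') (val mu') = val q ->
    s nu' ** s mu' = val (phi q) *: (s mu ** s nu);
  ck_TG3 : forall (v : Q L 0) (i : 'I_k),
    let vLi := [set e : Q L 1 | rng (val e) = val v /\ deg (val e) = basis_deg i] in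
    vLi !=set0 -> p v = \sum_(e \in vLi) (s e ** cstar (s e))
}.

(* (A, p, s) is a universal C*-algebra generated by a Cuntz-Krieger
   phi-representation; such a triple is unique up to canonical isomorphism. *)
Record is_twisted_algebra (R : realType) k (L : kgraph k)
    (phi : cochain L 2 (circle R)) (A : cstarAlgType R)
    (p : Q L 0 -> A) (s : Q L 1 -> A) : Prop := IsTwistedAlgebra {
  twisted_rep : ck_rep phi p s;
  twisted_generated : forall S : set A, closed_star_subalgebra S ->
    (forall v, S (p v)) -> (forall e, S (s e)) -> S = setT;
  twisted_universal : forall (B : cstarAlgType R) (P : Q L 0 -> B) (T : Q L 1 -> B),
    ck_rep phi P T ->
    exists! f : A -> B,
      [/\ star_hom f, forall v, f (p v) = P v & forall e, f (s e) = T e]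
}.

Section CrossedProduct.
Variables (R : realType) (A : cstarAlgType R) (alpha : star_aut A).

Definition star_aut_pow (n : int) : A -> A :=
  match n with
  | Posz m => iter m alpha
  | Negz m => iter m.+1 (star_aut_inv alpha)
  end.

Fact star_aut_pow0 n : star_aut_pow n 0 = 0.
Proof.
have h0 : alpha 0 = 0.
  have := star_hom_lin (star_aut_hom alpha) (-1) 0 0.
  by rewrite scaler0 addr0 scaleN1r addNr.
have i0 : star_aut_inv alpha 0 = 0 by rewrite -[in LHS]h0 star_aut_funK.
case: n => m; last first.
  by rewrite /star_aut_pow; elim: m.+1 => //= a ->.
by rewrite /star_aut_pow; elim: m => //= a ->.
Qed.

(* C_c(Z, A): the finitely supported functions Z -> A; f stands for the formal
   sum of the f(n) u^n, where u a u^* = alpha(a). *)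
Definition finitely_supported (f : int -> A) : Prop := finite_set [set n | f n != 0].
Definition Cc := {f : int -> A | finitely_supported f}.

Fact cmul0x (x : A) : 0 ** x = 0.
Proof. by have := cmulZl 0 0 x; rewrite !scale0r. Qed.
Fact cmulx0 (x : A) : x ** 0 = 0.
Proof. by have := cmulZr 0 x 0; rewrite !scale0r. Qed.
Fact cstar0 : cstar (0 : A) = 0.
Proof. by apply: (@addrI _ (cstar 0)); rewrite -cstarD !addr0. Qed.

Fact Cc_lin_subproof (a : R[i]) (f g : Cc) :
  finitely_supported (fun n => a *: sval f n + sval g n).
Proof.
have : finite_set ([set n | sval f n != 0] `|` [set n | sval g n != 0]).
  by rewrite finite_setU; split; [exact: (svalP f)|exact: (svalP g)].
apply: sub_finite_set => n /=; have [->|fn _] := eqVneq (sval f n) 0; last by left.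
by rewrite scaler0 add0r; right.
Qed.
Definition Cc_lin (a : R[i]) (f g : Cc) : Cc := exist finitely_supported _ (Cc_lin_subproof a f g).

Fact Cc_mul_subproof (f g : Cc) :
  finitely_supported (fun n => \sum_(m \in [set: int])
    (sval f m ** star_aut_pow m (sval g (n - m)))).
Proof.
have := finite_image2 (fun m l : int => m + l) (svalP f) (svalP g).
apply: sub_finite_set => n /=; apply: contraNP => nfg.
apply/eqP/fsbig1 => m _; have [->|fm] := eqVneq (sval f m) 0; first exact: cmul0x.
have [->|gm] := eqVneq (sval g (n - m)) 0; first by rewrite star_aut_pow0 cmulx0.
by case: nfg; exists m => //; exists (n - m) => //; rewrite addrC subrK.
Qed.
Definition Cc_mul (f g : Cc) : Cc := exist finitely_supported _ (Cc_mul_subproof f g).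

Fact Cc_star_subproof (f : Cc) :
  finitely_supported (fun n => star_aut_pow n (cstar (sval f (- n)))).
Proof.
have := finite_image (fun n : int => - n) (svalP f).
apply: sub_finite_set => n /=; have [->|fn _] := eqVneq (sval f (- n)) 0.
  by rewrite cstar0 star_aut_pow0 eqxx.
by exists (- n) => //; rewrite opprK.
Qed.
Definition Cc_star (f : Cc) : Cc := exist finitely_supported _ (Cc_star_subproof f).

Record Cc_star_hom (B : cstarAlgType R) (h : Cc -> B) : Prop := CcStarHom {
  Cc_hom_lin : forall (a : R[i]) f g, h (Cc_lin a f g) = a *: h f + h g;
  Cc_hom_mul : forall f g, h (Cc_mul f g) = h f ** h g;
  Cc_hom_star : forall f, h (Cc_star f) = cstar (h f)
}.

(* The full crossed product of A by alpha is the enveloping C*-algebra of the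
   *-algebra C_c(Z, A), i.e. its completion in the universal norm. *)
Record is_crossed_product (C : cstarAlgType R) (j : Cc -> C) : Prop :=
    IsCrossedProduct {
  crossed_hom : Cc_star_hom j;
  crossed_dense : closure (range j) = setT;
  crossed_universal : forall (B : cstarAlgType R) (h : Cc -> B), Cc_star_hom h ->
    exists! f : C -> B, star_hom f /\ forall x, f (j x) = h x
}.

End CrossedProduct.

(* Main.v *)
From mathcomp Require Import all_boot all_order all_algebra complex.
From mathcomp Require Import all_classical all_reals all_analysis.
From mathcomp Require Import ring lra.
Require Import Defs.
Import numFieldNormedType.Exports.

Set Implicit Arguments.
Unset Strict Implicit.
Unset Printing Implicit Defensive.

Import Order.TTheory GRing.Theory Num.Theory.
Local Open Scope classical_set_scope.
Local Open Scope ring_scope.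
Local Open Scope complex_scope.

(** Since the classes of psi and of its pullback agree, psi - b^* psi = delta c
    for some 1-cochain c.  Let phi agree with psi on the squares of Lambda and
    put phi(e,1) = - c(b^-1 e) on the squares having one edge in the new
    direction.  On a 3-cube (x,1) the faces contribute the coboundary of
    e |-> - c(b^-1 e) at x, the value psi(b^-1 x) and the value - psi(x), and
    these cancel; on the cubes of Lambda nothing has changed
    ([cocycle_cube_case]).  The same equation psi - b^* psi = delta c says
    that v |-> p_(bv), e |-> - c(e) s_(be) is again a psi-representation, so
    universality yields an endomorphism of the twisted algebra A, and the
    endomorphism obtained from b^-1 is its inverse ([twisted_automorphism]).

    Let B be the algebra of the crossed product graph, with generators q and t,
    and C the crossed product of A by Z, with j embedding the finitely
    supported functions.  The elements j(p_v), j(s_e) and j(p_v u) form a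
    phi-representation in C ([crossed_rep]), whence a homomorphism F from B
    to C.  In the other direction u should go to the sum U of all the t_(v,1).
    With infinitely many vertices this sum need not converge in B,
    but x |-> x U makes sense as a limit of multiplications by partial sums: these
    are contractions, and the x for which the limit exists form a closed left
    ideal containing every q_v, which is all of B ([left_ideal_full],
    [right_unitary_exists]).  The map x |-> x U is bijective, preserves the
    B-valued inner product (x, y) |-> x y^*, and implements the automorphism:
    x U pi(a) = x pi(beta a) U ([covariance]).  Therefore
    sum_n a_n u^n |-> sum_n pi(a_n) U^n is a homomorphism into B
    ([integrated_hom]) and extends to C.  The two maps are mutually inverse
    ([isomorphic_crossed]).

    Two analytic facts enter.  Homomorphisms of C-star algebras are bounded
    ([star_hom_bounded]), and a projection that is a finite sum of projections
    absorbs each of them ([subproj_of_sum]); the latter turns [ck_TG3] into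
    p_(r(e)) s_e = s_e.  Both follow from one elementary device.  If a and d
    are commuting selfadjoint elements with a^2 + (1-d)^2 = 1, then
    a + i(1-d) is isometric, so that its real part a and its imaginary part
    1-d are contractions ([half_contraction]); and for small a such a d is the
    fixed point of d |-> (a^2 + d^2)/2 ([sqrt_complement]). *)

(** * Linear identities in abelian groups *)

(** A normal form for group expressions: [zmod] proves an identity that holds
    in every abelian group by comparing the integer coefficients of its atoms. *)
Inductive zexp := ZVar of nat | ZZero | ZAdd of zexp & zexp | ZOpp of zexp | ZMuln of zexp & nat.

Fixpoint zeval (V : zmodType) (env : seq V) (e : zexp) : V :=
  match e with
  | ZVar i => env`_i
  | ZZero => 0
  | ZAdd a b => zeval env a + zeval env b
  | ZOpp a => - zeval env a
  | ZMuln a n => zeval env a *+ n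
  end.

Fixpoint zcoef (e : zexp) (i : nat) : int :=
  match e with
  | ZVar j => (i == j)%:Z
  | ZZero => 0
  | ZAdd a b => zcoef a i + zcoef b i
  | ZOpp a => - zcoef a i
  | ZMuln a n => zcoef a i *+ n
  end.

Lemma zevalE (V : zmodType) (env : seq V) (e : zexp) :
  zeval env e = \sum_(i < size env) env`_i *~ zcoef e i.
Proof.
elim: e => [j||a IHa b IHb|a IHa|a IHa n] /=; rewrite ?IHa ?IHb.
- have [jn|jn] := ltnP j (size env).
    rewrite (bigD1 (Ordinal jn))//= eqxx mulr1z big1 ?addr0// => i.
    by rewrite -val_eqE /= => /negPf ->; rewrite mulr0z.
  rewrite nth_default// big1// => i _.
  by rewrite [_ == j]ltn_eqF ?mulr0z// (leq_trans _ jn).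
- by rewrite big1// => i _; rewrite mulr0z.
- by rewrite -big_split/=; apply: eq_bigr => i _; rewrite mulrzDr.
- by rewrite -sumrN; apply: eq_bigr => i _; rewrite mulrNz.
- by rewrite -sumrMnl; apply: eq_bigr => i _; rewrite pmulrn -mulrzA -mulr_natr natz.
Qed.

Lemma zeval_eq (V : zmodType) (env : seq V) (a b : zexp) :
  all (fun i => zcoef a i == zcoef b i) (iota 0 (size env)) -> zeval env a = zeval env b.
Proof.
move=> /allP h; rewrite !zevalE; apply: eq_bigr => i _; congr (_ *~ _).
by apply/eqP/h; rewrite mem_iota ltn_ord.
Qed.

Ltac zmod_find x l :=
  lazymatch l with
  | x :: _ => constr:(0%N)
  | _ :: ?l => let n := zmod_find x l in constr:(S n)
  end.
Ltac zmod_mem x l :=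
  lazymatch l with
  | nil => constr:(false)
  | x :: _ => constr:(true)
  | _ :: ?l => zmod_mem x l
  end.
Ltac zmod_atoms t l :=
  lazymatch t with
  | (?a + ?b)%R => let l := zmod_atoms a l in zmod_atoms b l
  | (- ?a)%R => zmod_atoms a l
  | (?a *+ _)%R => zmod_atoms a l
  | 0%R => l
  | _ => lazymatch zmod_mem t l with true => l | _ => constr:(t :: l) end
  end.
Ltac zmod_reify t l :=
  lazymatch t with
  | (?a + ?b)%R => let a := zmod_reify a l in let b := zmod_reify b l in constr:(ZAdd a b)
  | (- ?a)%R => let a := zmod_reify a l in constr:(ZOpp a)
  | (?a *+ ?n)%R => let a := zmod_reify a l in constr:(ZMuln a n)
  | 0%R => constr:(ZZero)
  | _ => let n := zmod_find t l in constr:(ZVar n)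
  end.
Ltac zmod :=
  lazymatch goal with
  | |- @eq ?V ?a ?b =>
    let l := zmod_atoms a (@nil V) in let l := zmod_atoms b l in
    let ea := zmod_reify a l in let eb := zmod_reify b l in
    refine (@zeval_eq _ l ea eb _); vm_compute; reflexivity
  end.

(** * Norms and limits in a C-star algebra *)

Section RealNorm.
Variables (R : realType) (A : cstarAlgType R).
Implicit Types x y z : A.

(** Norms are complex-valued here, and the order of the complex numbers is only
    partial; real norms bring linear real arithmetic back. *)
Definition nm x : R := complex.Re `|x|.

Lemma norm_nm x : `|x| = (nm x)%:C.
Proof. by rewrite /nm RRe_real// normr_real. Qed.

Lemma nm_ge0 x : 0 <= nm x.
Proof. by rewrite -lecR -norm_nm normr_ge0. Qed.

Lemma nm_eq0 x : nm x <= 0 -> x = 0.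
Proof.
move=> x0; apply/eqP; rewrite -normr_eq0 norm_nm.
by have -> : nm x = 0 by apply/eqP; rewrite eq_le x0 nm_ge0.
Qed.

Lemma nm0 : nm 0 = 0.
Proof. by rewrite /nm normr0. Qed.

Lemma nmD x y : nm (x + y) <= nm x + nm y.
Proof. by rewrite -lecR rmorphD /= -!norm_nm ler_normD. Qed.

Lemma nmN x : nm (- x) = nm x.
Proof. by rewrite /nm normrN. Qed.

Lemma nmBC x y : nm (x - y) = nm (y - x).
Proof. by rewrite -nmN opprB. Qed.

Lemma nmB x y : nm (x - y) <= nm x + nm y.
Proof. by rewrite -(nmN y) nmD. Qed.

Lemma nm_triangle z x y : nm (x - y) <= nm (x - z) + nm (z - y).
Proof. by have := nmD (x - z) (z - y); rewrite addrA subrK. Qed.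

Lemma nmZ (a : R[i]) x : nm (a *: x) = complex.Re `|a| * nm x.
Proof.
have := normrZ a x; rewrite (norm_nm (a *: x)) (norm_nm x).
by rewrite -{1}(RRe_real (normr_real a)) -rmorphM => /complexI.
Qed.

Lemma nmZr (r : R) x : nm (r%:C *: x) = `|r| * nm x.
Proof. by rewrite nmZ normc_def /= expr0n /= addr0 sqrtr_sqr. Qed.

Lemma nmZ_ge0 (r : R) x : 0 <= r -> nm (r%:C *: x) = r * nm x.
Proof. by move=> r0; rewrite nmZr ger0_norm. Qed.

Lemma nmMn x n : nm (x *+ n) = nm x *+ n.
Proof. by rewrite /nm normrMn raddfMn. Qed.

Lemma nmM x y : nm (x ** y) <= nm x * nm y.
Proof. by rewrite -lecR rmorphM /= -!norm_nm cnorm_mul. Qed.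

Lemma nm_star_mul x : nm (cstar x ** x) = nm x ^+ 2.
Proof.
by apply: (@complexI R); rewrite -norm_nm cnorm_star rmorphXn /= -norm_nm.
Qed.

Lemma nm_star x : nm (cstar x) = nm x.
Proof.
have le y : nm y <= nm (cstar y).
  have [->|y0] := eqVneq (nm y) 0; first exact: nm_ge0.
  have := nmM (cstar y) y; rewrite nm_star_mul expr2 ler_pM2r//.
  by rewrite lt_neqAle eq_sym y0 nm_ge0.
by apply/eqP; rewrite eq_le le -{2}(cstarK x) le.
Qed.

Lemma nm_mul_star x : nm (x ** cstar x) = nm x ^+ 2.
Proof. by rewrite -{1}(cstarK x) nm_star_mul nm_star. Qed.

Lemma nm_self x : cstar x = x -> nm (x ** x) = nm x ^+ 2.
Proof. by move=> sx; rewrite -nm_star_mul sx. Qed.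

Lemma cmulNl x y : (- x) ** y = - (x ** y).
Proof. by rewrite -(scaleN1r x) cmulZl scaleN1r. Qed.
Lemma cmulNr x y : x ** (- y) = - (x ** y).
Proof. by rewrite -(scaleN1r y) cmulZr scaleN1r. Qed.
Lemma cmulBl x y z : (x - y) ** z = x ** z - y ** z.
Proof. by rewrite cmulDl cmulNl. Qed.
Lemma cmulBr x y z : x ** (y - z) = x ** y - x ** z.
Proof. by rewrite cmulDr cmulNr. Qed.
Lemma cstarN x : cstar (- x) = - cstar x.
Proof. by apply: (@addrI _ (cstar x)); rewrite -cstarD !subrr cstar0. Qed.
Lemma cstarB x y : cstar (x - y) = cstar x - cstar y.
Proof. by rewrite cstarD cstarN. Qed.
Lemma conjc_realC (r : R) : ((r%:C : R[i])^*)%R = r%:C.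
Proof. by apply: conj_Creal; apply/complex_realP; exists r. Qed.
Lemma cstarZr (r : R) x : cstar (r%:C *: x) = r%:C *: cstar x.
Proof. by rewrite cstarZ conjc_realC. Qed.
Lemma conjci : (('i%C : R[i])^*)%R = - 'i%C.
Proof. by rewrite /=; apply/eqP; rewrite eq_complex /= oppr0 !eqxx. Qed.

Lemma cmul_suml (I : Type) (r : seq I) (P : pred I) (F : I -> A) x :
  (\sum_(i <- r | P i) F i) ** x = \sum_(i <- r | P i) (F i ** x).
Proof. by elim/big_rec2: _ => [|i y z _ <-]; rewrite ?cmul0x// cmulDl. Qed.
Lemma cmul_sumr (I : Type) (r : seq I) (P : pred I) (F : I -> A) x :
  x ** (\sum_(i <- r | P i) F i) = \sum_(i <- r | P i) (x ** F i).
Proof. by elim/big_rec2: _ => [|i y z _ <-]; rewrite ?cmulx0// cmulDr. Qed.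
Lemma cstar_sum (I : Type) (r : seq I) (P : pred I) (F : I -> A) :
  cstar (\sum_(i <- r | P i) F i) = \sum_(i <- r | P i) cstar (F i).
Proof. by elim/big_rec2: _ => [|i y z _ <-]; rewrite ?cstar0// cstarD. Qed.
Lemma nm_sum (I : Type) (r : seq I) (P : pred I) (F : I -> A) :
  nm (\sum_(i <- r | P i) F i) <= \sum_(i <- r | P i) nm (F i).
Proof.
elim/big_rec2: _ => [|i y z _ yz]; rewrite ?nm0//.
by apply: le_trans (nmD _ _) _; rewrite lerD2l.
Qed.

Lemma star_mul_eq0 x : cstar x ** x = 0 -> x = 0.
Proof.
move=> x0; apply: nm_eq0; have := nm_star_mul x; rewrite x0 nm0.
by move=> /esym/eqP; rewrite sqrf_eq0 => /eqP ->.
Qed.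
Lemma mul_eq0_all x : (forall y, y ** x = 0) -> x = 0.
Proof. by move=> h; apply: star_mul_eq0. Qed.
Lemma mul_eq0_allr x : (forall y, x ** y = 0) -> x = 0.
Proof.
move=> x0; rewrite -(cstarK x); suff -> : cstar x = 0 by rewrite cstar0.
by apply: star_mul_eq0; rewrite cstarK.
Qed.

(** Positive complex radii are real, so real radii suffice. *)
Lemma closed_nmP (S : set A) :
  closed S <-> forall x, (forall e : R, 0 < e -> exists2 y, S y & nm (x - y) < e) -> S x.
Proof.
split=> [clS x xS|h x xS].
  apply: clS => N /nbhs_ballP[e /= e0 eN].
  have e_re : e = (complex.Re e)%:C by rewrite RRe_real// gtr0_real.
  have {}e0 : 0 < complex.Re e by rewrite -ltcR -e_re.
  have [y Sy xy] := xS _ e0; exists y; split=> //.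
  apply: eN; rewrite -ball_normE /= norm_nm e_re.
  by rewrite ltcR.
apply: h => e e0; have ec : 0 < e%:C :> R[i] by rewrite ltcR.
have [y [Sy]] := xS _ (nbhsx_ballx x _ ec).
by rewrite -ball_normE /= norm_nm ltcR; exists y.
Qed.

Definition tends (u : nat -> A) (l : A) :=
  forall e : R, 0 < e -> exists N, forall n, (N <= n)%N -> nm (u n - l) < e.

Lemma tends_cauchy (u : nat -> A) :
  (forall e : R, 0 < e -> exists N, forall n, (N <= n)%N -> nm (u n - u N) < e) ->
  exists l, tends u l.
Proof.
move=> hu; have /cauchy_cvg cu : cauchy (u @ \oo).
  apply: cauchy_exP => e e0.
  have e_re : e = (complex.Re e)%:C by rewrite RRe_real// gtr0_real.
  have {}e0 : 0 < complex.Re e by rewrite -ltcR -e_re.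
  have [N hN] := hu _ e0; exists (u N); exists N => // n /= /hN.
  by rewrite -ball_normE /= norm_nm e_re ltcR nmBC.
exists (lim (u @ \oo)) => e e0.
have ec : 0 < e%:C :> R[i] by rewrite ltcR.
have /cvgrPdist_lt /(_ _ ec) [N _ hN] := cu.
by exists N => n /hN /=; rewrite norm_nm ltcR nmBC.
Qed.

Lemma tends_unique u l m : tends u l -> tends u m -> l = m.
Proof.
move=> ul um; apply/eqP; rewrite -subr_eq0; apply/eqP/nm_eq0.
rewrite leNgt; apply/negP => lm.
have e0 : 0 < nm (l - m) / 2 by rewrite divr_gt0.
have [N1 h1] := ul _ e0; have [N2 h2] := um _ e0.
have := h1 _ (leq_maxl N1 N2); have := h2 _ (leq_maxr N1 N2).
move: (u _) => t; have := nm_triangle t l m; rewrite (nmBC l t); lra.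
Qed.

Lemma tends_eventually u l N : (forall n, (N <= n)%N -> u n = l) -> tends u l.
Proof. by move=> h e e0; exists N => n /h ->; rewrite subrr nm0. Qed.

Lemma tends_shift u l : tends u l -> tends (fun n => u n.+1) l.
Proof. by move=> ul e /ul[N h]; exists N => n Nn; apply: h; rewrite leqW. Qed.

Lemma tendsD u v l m : tends u l -> tends v m -> tends (fun n => u n + v n) (l + m).
Proof.
move=> ul vm e e0; have e2 : 0 < e / 2 by rewrite divr_gt0.
have [N1 h1] := ul _ e2; have [N2 h2] := vm _ e2; exists (maxn N1 N2) => n.
rewrite geq_max => /andP[/h1 {}h1 /h2 {}h2].
rewrite opprD addrACA; have := nmD (u n - l) (v n - m); lra.
Qed.

Lemma tends_nm_le u l (K : R) : tends u l -> (forall n, nm (u n) <= K) -> nm l <= K.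
Proof.
move=> ul uK; rewrite leNgt; apply/negP => lK.
have e0 : 0 < nm l - K by rewrite subr_gt0.
have [N /(_ _ (leqnn N))] := ul _ e0; have := uK N.
by have := nmD (u N) (l - u N); rewrite addrC subrK nmBC; lra.
Qed.

End RealNorm.

Lemma tends_lip (R : realType) (A B : cstarAlgType R) (f : A -> B) (K : R) u l :
  (forall x y, nm (f x - f y) <= K * nm (x - y)) -> tends u l -> tends (f \o u) (f l).
Proof.
move=> fK ul e e0; have K0 : 0 < `|K| + 1 by rewrite ltr_wpDl.
have [N h] := ul (e / (`|K| + 1)) (divr_gt0 e0 K0); exists N => n /h.
rewrite ltr_pdivlMr// => hh; apply: le_lt_trans (fK _ _) (le_lt_trans _ hh).
rewrite mulrC ler_wpM2l ?nm_ge0//; apply: le_trans (ler_norm _) _.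
by rewrite lerDl.
Qed.

Lemma closed_preimage_lip (R : realType) (A B : cstarAlgType R) (f : A -> B) (K : R)
  (S : set B) : (forall x y, nm (f x - f y) <= K * nm (x - y)) ->
  closed S -> closed [set x | S (f x)].
Proof.
move=> fK /closed_nmP clS; apply/closed_nmP => x hx; apply: clS => e e0.
have K0 : 0 < `|K| + 1 by rewrite ltr_wpDl.
have [y Sy xy] := hx (e / (`|K| + 1)) (divr_gt0 e0 K0); exists (f y) => //.
move: xy; rewrite ltr_pdivlMr// => hh; apply: le_lt_trans (fK _ _) (le_lt_trans _ hh).
rewrite mulrC ler_wpM2l ?nm_ge0//; apply: le_trans (ler_norm _) _.
by rewrite lerDl.
Qed.

(** * Contractions from square roots *)

Lemma sumr_const_seq (V : nmodType) (I : Type) (r : seq I) (x : V) :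
  \sum_(i <- r) x = x *+ size r.
Proof. by elim: r => [|i r IH]; rewrite ?big_nil// big_cons IH mulrS. Qed.

Section SquareRoot.
Variables (R : realType) (A : cstarAlgType R).
Implicit Types a b d e x y z : A.

Lemma tends_geometric (u : nat -> A) :
  (forall n, nm (u n.+1 - u n) <= 2^-1 ^+ n) -> exists l, tends u l.
Proof.
move=> hu; apply: tends_cauchy => e e0.
have step N k : nm (u (N + k)%N - u N) <= 2 * 2^-1 ^+ N - 2 * 2^-1 ^+ (N + k).
  elim: k => [|k IH]; first by rewrite addn0 !subrr nm0.
  have := nm_triangle (u (N + k)%N) (u (N + k.+1)%N) (u N).
  have := hu (N + k)%N; rewrite addnS exprS.
  by move: IH; move: (_ ^+ (N + k)) (2^-1 ^+ N) => p q h1 h2 h3; lra.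
pose N := Num.bound (2 / e); exists N => n /subnK <-; rewrite addnC.
apply: le_lt_trans (step _ _) _; set p := _ ^+ (_ + _).
have p0 : 0 < p by rewrite exprn_gt0// invr_gt0.
have := upper_nthrootP (leqnn N); rewrite ltr_pdivrMr// exprVn => h.
have : 2 / 2 ^+ N < e by rewrite ltr_pdivrMr ?exprn_gt0// mulrC.
lra.
Qed.

(** [d] is 1 - (1 - a^2)^(1/2), the limit of the iterates of
    d |-> (a^2 + d^2)/2 started at 0.  This map preserves the ball of radius 1/2
    and halves distances there, which is where the bound 3/4 comes from:
    (3/4 + 1/4)/2 = 1/2. *)
Lemma sqrt_complement a : cstar a = a -> nm (a ** a) <= 3 / 4 ->
  exists d, [/\ cstar d = d, a ** d = d ** a & d + d = a ** a + d ** d].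
Proof.
move=> sa na; pose f x : A := (2^-1 : R)%:C *: (a ** a + x ** x).
pose u n := iter n f 0.
have half_add (x : A) : (2^-1 : R)%:C *: x + (2^-1 : R)%:C *: x = x.
  rewrite -scalerDl -rmorphD /=.
  have -> : 2^-1 + 2^-1 = 1 :> R by lra.
  by rewrite scale1r.
have inv n : [/\ cstar (u n) = u n, a ** u n = u n ** a & nm (u n) <= 1 / 2].
  elim: n => [|n [IH1 IH2 IH3]]; first by rewrite cstar0 cmul0x cmulx0 nm0; split=> //; lra.
  rewrite /u iterS -/(u n) /f; split.
  - by rewrite cstarZr cstarD !cstarM sa IH1.
  - by rewrite cmulZr cmulZl cmulDr cmulDl !cmulA IH2 -!cmulA IH2.
  rewrite nmZ_ge0 ?invr_ge0//; have := nmD (a ** a) (u n ** u n).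
  have := nmM (u n) (u n); have := nm_ge0 (u n).
  by move: (nm _) IH3 => p h1 h2 h3 h4; nra.
have fsub x y : nm x <= 1 / 2 -> nm y <= 1 / 2 -> nm (f x - f y) <= 2^-1 * nm (x - y).
  move=> nx ny.
  have -> : f x - f y = (2^-1 : R)%:C *: (x ** (x - y) + (x - y) ** y).
    rewrite /f -scalerBr; congr (_ *: _).
    by rewrite opprD addrACA subrr add0r cmulBr cmulBl addrA subrK.
  rewrite nmZ_ge0 ?invr_ge0// ler_pM2l ?invr_gt0//.
  have h1 := nmD (x ** (x - y)) ((x - y) ** y).
  have h2 := nmM x (x - y); have h3 := nmM (x - y) y.
  have := nm_ge0 (x - y); move: (nm (x - y)) h2 h3 => p h2 h3 p0.
  by move: (nm x) (nm y) nx ny h2 h3 => q r i1 i2 h2 h3; nra.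
have step n : nm (u n.+1 - u n) <= 2^-1 ^+ n.
  elim: n => [|n IH].
    have [_ _] := inv 1%N; rewrite expr0 [u 0%N]/= subr0; lra.
  have [_ _ i1] := inv n; have [_ _ i2] := inv n.+1.
  by apply: le_trans (fsub _ _ i2 i1) _; rewrite exprS ler_pM2l ?invr_gt0.
have [d ud] := tends_geometric step; exists d.
have nd : nm d <= 1 / 2 by apply: tends_nm_le ud _ => n; case: (inv n).
have lip (g : A -> A) K : (forall x y, nm (g x - g y) <= K * nm (x - y)) ->
  (forall n, g (u n) = u n) -> g d = d.
  move=> gK gu; apply: tends_unique (tends_lip gK ud) _.
  by have -> : g \o u = u by apply/funext => n /=.
split.
- by apply: (lip _ 1) => [x y|n]; rewrite -?cstarB ?nm_star ?mul1r//; case: (inv n).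
- apply: (@tends_unique _ _ (fun n => a ** u n)).
    by apply: (tends_lip (f := fun x => a ** x) (K := nm a) _ ud) => x y; rewrite -cmulBr nmM.
  have -> : (fun n => a ** u n) = (fun n => u n ** a).
    by apply/funext => n; case: (inv n).
  by apply: (tends_lip (f := fun x => x ** a) (K := nm a) _ ud) => x y; rewrite -cmulBl mulrC nmM.
suff df : d = f d by rewrite [in LHS]df /f half_add.
apply: tends_unique (tends_shift ud) _ => e e0.
have [N hN] := ud _ e0; exists N => n /hN h; have [_ _ nu] := inv n.
apply: le_lt_trans _ h; have := fsub _ _ nu nd; have := nm_ge0 (u n - d); rewrite /u iterS; lra.
Qed.

(** The element b + i(1-e) is an isometry, because b^2 + (1-e)^2 = 1 and the
    cross terms cancel when b and e commute. *)
Lemma half_isometry b e x :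
  cstar b = b -> cstar e = e -> b ** e = e ** b -> e + e = b ** b + e ** e ->
  nm (b ** x + 'i%C *: (x - e ** x)) = nm x.
Proof.
move=> sb se be ebe; set y := b ** x; set z := x - e ** x.
have sz : cstar z = cstar x - cstar x ** e by rewrite /z cstarB cstarM se.
have yz : cstar y ** z = cstar z ** y.
  rewrite sz /y /z cstarM sb cmulBr cmulBl -!cmulA; congr (_ - _).
  by rewrite !cmulA -(cmulA _ b e) be !cmulA.
have yyzz : cstar y ** y + cstar z ** z = cstar x ** x.
  rewrite sz /y /z cstarM sb cmulBl !cmulBr -!cmulA -!cmulBr -cmulDr; congr (_ ** _).
  have -> : b ** (b ** x) = e ** x + e ** x - e ** (e ** x).
    by rewrite !cmulA -cmulDl -cmulBl ebe addrK.
  rewrite cmulBr opprB addrACA addKr addrA -addrA -opprD.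
  by rewrite [e ** x + e ** x + x]addrC addrK.
have : nm (y + 'i%C *: z) ^+ 2 = nm x ^+ 2.
  rewrite -!nm_star_mul cstarD cstarZ conjci cmulDl !cmulDr !cmulZl !cmulZr scalerA.
  rewrite yz mulNr -expr2 sqr_i opprK scale1r scaleNr.
  by rewrite addrA addrK yyzz.
by move=> /eqP; rewrite eqrXn2 ?nm_ge0// => /eqP.
Qed.

Lemma nm_i x : nm ('i%C *: x) = nm x.
Proof. by rewrite nmZ normc_def /= expr0n expr1n /= add0r sqrtr1 mul1r. Qed.

(** b and i(1-e) are half the difference and half the sum of the isometries
    b + i(1-e) and -b + i(1-e).
    The hypotheses are algebraic, hence inherited by homomorphic images. *)
Lemma half_contraction b e x :
  cstar b = b -> cstar e = e -> b ** e = e ** b -> e + e = b ** b + e ** e ->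
  nm (b ** x) <= nm x /\ nm (x - e ** x) <= nm x.
Proof.
move=> sb se be ebe; have h1 := half_isometry x sb se be ebe.
have h2 : nm (- (b ** x) + 'i%C *: (x - e ** x)) = nm x.
  rewrite -cmulNl; apply: half_isometry => //.
  - by rewrite cstarN sb.
  - by rewrite cmulNl cmulNr be.
  - by rewrite cmulNl cmulNr opprK.
move: h1 h2; set y := b ** x; set z := 'i%C *: _ => h1 h2; split.
  have := nmB (y + z) (- y + z); rewrite h1 h2.
  have -> : y + z - (- y + z) = y *+ 2.
    by rewrite opprD opprK addrACA subrr addr0 mulr2n.
  rewrite nmMn mulr2n; lra.
have := nmD (y + z) (- y + z); rewrite h1 h2.
have -> : y + z + (- y + z) = z *+ 2 by rewrite addrACA subrr add0r mulr2n.
rewrite nmMn mulr2n nm_i; lra.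
Qed.

Definition projection (p : A) := p ** p = p /\ cstar p = p.

(** Expanding the adjoint square of s - s p gives p - p - p + p. *)
Lemma isometry_source p s : projection p -> cstar s ** s = p -> s ** p = s.
Proof.
move=> [pp sp] ss; apply/esym/eqP; rewrite -subr_eq0; apply/eqP/star_mul_eq0.
rewrite cstarB cstarM sp cmulBl !cmulBr -!cmulA !(cmulA (cstar s) s).
by rewrite ss !pp !subrr.
Qed.

Lemma proj_contraction p x : projection p -> nm (p ** x) <= nm x.
Proof.
move=> [pp sp]; have [px|px] := leP (nm (p ** x)) 0; first exact: le_trans px (nm_ge0 x).
have := nmM (cstar x) (p ** x); rewrite nm_star.
have -> : cstar x ** (p ** x) = cstar (p ** x) ** (p ** x).
  by rewrite cstarM sp -!cmulA (cmulA p p) pp.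
by rewrite nm_star_mul expr2 ler_pM2r.
Qed.

Lemma coproj_contraction p x : projection p -> nm (x - p ** x) <= nm x.
Proof.
move=> [pp sp]; set y := x - p ** x.
have [px|px] := leP (nm y) 0; first exact: le_trans px (nm_ge0 x).
have := nmM (cstar x) y; rewrite nm_star.
have py : p ** y = 0 by rewrite cmulBr cmulA pp subrr.
have -> : cstar x ** y = cstar y ** y.
  by rewrite {2}/y cstarB cstarM sp cmulBl -cmulA py cmulx0 subr0.
by rewrite nm_star_mul expr2 ler_pM2r.
Qed.

(** 1 + w and 1 - w act as contractions on the right ideal q A.  For a
    selfadjoint w this means that the spectrum of w contains only 0
    ([corner_contraction_eq0]). *)
Definition corner_contraction (q w : A) :=
  forall x, q ** x = x -> nm (x + w ** x) <= nm x /\ nm (x - w ** x) <= nm x.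

(** From 4 w = (1+w)^2 - (1-w)^2. *)
Lemma corner_contraction_half q w : cstar w = w -> q ** w = w ->
  corner_contraction q w -> nm w <= 1 / 2.
Proof.
move=> sw qw cw.
have h x : q ** x = x -> nm (w ** x) *+ 4 <= nm x *+ 2.
  move=> qx; have [h1 h2] := cw x qx.
  have qwx : q ** (w ** x) = w ** x by rewrite cmulA qw.
  have qp : q ** (x + w ** x) = x + w ** x by rewrite cmulDr qx qwx.
  have qm : q ** (x - w ** x) = x - w ** x by rewrite cmulBr qx qwx.
  have [h3 _] := cw _ qp; have [_ h4] := cw _ qm.
  have := nmB (x + w ** x + w ** (x + w ** x)) (x - w ** x - w ** (x - w ** x)).
  have -> : x + w ** x + w ** (x + w ** x) - (x - w ** x - w ** (x - w ** x)) = w ** x *+ 4.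
    by rewrite cmulDr cmulBr; zmod.
  by rewrite nmMn; lra.
have := h w qw; rewrite nm_self//; have := nm_ge0 w; move: (nm w) => t.
move=> t0 ht; have [->|tn0] := eqVneq t 0; first lra.
have {}t0 : 0 < t by rewrite lt_neqAle eq_sym tn0.
nra.
Qed.

Lemma corner_contractionN q w : corner_contraction q w -> corner_contraction q (- w).
Proof. by move=> cw x /cw[h1 h2]; rewrite cmulNl opprK; split. Qed.

(** As w has norm at most 1/2, 1 - (9/4) w^2 = (1-d)^2 is a contraction for some
    d by [sqrt_complement]; the convex combination
    (9/13)(1+w)^2 + (4/13)(1 - (9/4)w^2) = 1 + (18/13)w is then one too. *)
Lemma corner_contraction_grow q w : cstar w = w -> q ** w = w ->
  corner_contraction q w -> corner_contraction q ((18 / 13 : R)%:C *: w).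
Proof.
have plus v x : cstar v = v -> q ** v = v -> corner_contraction q v -> q ** x = x ->
    nm (x + (18 / 13 : R)%:C *: (v ** x)) <= nm x.
  move=> sv qv cv qx; have nv := corner_contraction_half sv qv cv.
  pose a := (3 / 2 : R)%:C *: v.
  have sa : cstar a = a by rewrite /a cstarZr sv.
  have aa : a ** a = (9 / 4 : R)%:C *: (v ** v).
    rewrite /a cmulZl cmulZr scalerA -rmorphM /=; congr (_%:C *: _); lra.
  have na : nm (a ** a) <= 3 / 4.
    rewrite aa nmZ_ge0; last lra.
    rewrite nm_self//; have := nm_ge0 v; move: (nm v) nv => t; nra.
  have [d [sd ad dd]] := sqrt_complement sa na.
  have [_ c1] := half_contraction x sa sd ad dd.
  have [_ c2] := half_contraction (x - d ** x) sa sd ad dd.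
  have {c1}c2 := le_trans c2 c1.
  have dx : x - d ** x - d ** (x - d ** x) = x - (9 / 4 : R)%:C *: (v ** (v ** x)).
    rewrite cmulA -cmulZl -aa cmulBr cmulA.
    have -> : (a ** a) ** x = d ** x + d ** x - (d ** d) ** x.
      by rewrite -cmulDl -cmulBl dd addrK.
    by zmod.
  rewrite {}dx in c2.
  have [c1 _] := cv x qx.
  have qp : q ** (x + v ** x) = x + v ** x by rewrite cmulDr cmulA qv qx.
  have [c3 _] := cv _ qp; have {c1}c3 := le_trans c3 c1.
  have -> : x + (18 / 13 : R)%:C *: (v ** x) =
      (9 / 13 : R)%:C *: (x + v ** x + v ** (x + v ** x))
      + (4 / 13 : R)%:C *: (x - (9 / 4 : R)%:C *: (v ** (v ** x))).
    rewrite cmulDr !scalerDr scalerN scalerA -rmorphM /=.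
    have -> : 4 / 13 * (9 / 4) = 9 / 13 :> R by field.
    have -> : (18 / 13 : R)%:C *: (v ** x) = (9 / 13 : R)%:C *: (v ** x) + (9 / 13 : R)%:C *: (v ** x).
      by rewrite -scalerDl -rmorphD /=; congr (_%:C *: _); field.
    have xE : x = (9 / 13 : R)%:C *: x + (4 / 13 : R)%:C *: x.
      rewrite -scalerDl -rmorphD /= -[LHS]scale1r; congr (_ *: _).
      by apply/eqP; rewrite eq_complex /= eqxx andbT; apply/eqP; field.
    rewrite {1}xE; set u := (9 / 13)%:C *: (v ** x).
    set t := (9 / 13)%:C *: (v ** (v ** x)); set s := (9 / 13)%:C *: x; set s' := (4 / 13)%:C *: x.
    zmod.
  have := nmD ((9 / 13 : R)%:C *: (x + v ** x + v ** (x + v ** x)))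
    ((4 / 13 : R)%:C *: (x - (9 / 4 : R)%:C *: (v ** (v ** x)))).
  rewrite !nmZ_ge0; [lra | lra | lra].
move=> sw qw cw x qx; rewrite cmulZl; split; first exact: plus.
have := plus (- w) x; rewrite cmulNl cmulNr scalerN cstarN sw qw; apply=> //.
exact: corner_contractionN.
Qed.

(** All the multiples (18/13)^n w keep norm at most 1/2. *)
Lemma corner_contraction_eq0 q w : cstar w = w -> q ** w = w ->
  corner_contraction q w -> w = 0.
Proof.
move=> sw qw cw; have bound n : (18 / 13) ^+ n * nm w <= 1 / 2.
  elim: n w sw qw cw => [|n IH] w sw qw cw.
    by rewrite expr0 mul1r; exact: corner_contraction_half cw.
  have := IH _ _ _ (corner_contraction_grow sw qw cw).
  rewrite cstarZr sw cmulZr qw exprSr -mulrA nmZ_ge0; last lra.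
  by apply.
have grow n : n%:R / 4 <= (18 / 13) ^+ n :> R.
  elim: n => [|n IH]; first by rewrite mul0r expr0.
  have h1 : 1 <= (18 / 13) ^+ n :> R by apply: exprn_ege1; lra.
  by rewrite exprS -natr1; lra.
(* a large n contradicts the bound unless w has norm 0 *)
apply: nm_eq0; rewrite leNgt; apply/negP => w0.
have := bound (Num.bound (4 / nm w)); have := grow (Num.bound (4 / nm w)).
have := archi_boundP (divr_ge0 (ler0n R 4) (ltW w0)).
rewrite ltr_pdivrMr//; move: (_ ^+ _) (Num.bound _)%:R => s t h1 h2 h3.
have : t / 4 * nm w <= s * nm w by rewrite ler_pM2r.
lra.
Qed.

(** In the corner q A q, the element X = q p q - q is the sum of the q F_i q.
    Hence q + X = q p q is a contraction, and so is q - X/n, being the average of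
    the q (1 - F_i) q, where n is the number of the F_i.  By convexity X/(n+1)
    satisfies [corner_contraction], so X = 0 and (1-p)q = 0. *)
Lemma subproj_of_sum (I : Type) (r : seq I) (F : I -> A) p q :
  projection q -> projection p -> (forall i, projection (F i)) ->
  p = q + \sum_(i <- r) F i -> p ** q = q.
Proof.
move=> pq pp pF pE; have [qq sq] := pq; have [ppp sp] := pp.
pose X := q ** p ** q - q.
have XE : X = \sum_(i <- r) (q ** F i ** q).
  by rewrite /X pE cmulDr cmulDl qq qq addrC addKr cmul_sumr cmul_suml.
have sX : cstar X = X by rewrite /X cstarB !cstarM sp sq cmulA.
have qX : q ** X = X by rewrite /X cmulBr !cmulA qq.
pose N := (size r).+1; pose c : R := N%:R^-1.
have N0 : 0 < N%:R :> R by rewrite ltr0n.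
have c0 : 0 <= c by rewrite invr_ge0 ltW.
have main y x : nm (x *+ N + y) <= nm x *+ N -> nm (x + c%:C *: y) <= nm x.
  move=> h; have -> : x + c%:C *: y = c%:C *: (x *+ N + y).
    rewrite scalerDr -scaler_nat scalerA.
    have -> : c%:C * N%:R = 1 :> R[i].
      have -> : (N%:R : R[i]) = (N%:R : R)%:C by rewrite rmorph_nat.
      by rewrite -rmorphM /= mulVf// gt_eqF.
    by rewrite scale1r.
  rewrite nmZ_ge0// -(ler_pM2l N0) mulrA divff ?gt_eqF// mul1r.
  by rewrite mulr_natl.
have w0 : c%:C *: X = 0.
  apply: (@corner_contraction_eq0 q); rewrite ?cstarZr ?sX// ?cmulZr ?qX// => x qx.
  rewrite cmulZl; split.
    apply: main; rewrite mulrSr -addrA mulrSr.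
    have -> : x + X ** x = q ** (p ** x).
      by rewrite cmulBl qx addrC subrK -!cmulA qx.
    have := nmD (x *+ size r) (q ** (p ** x)); rewrite nmMn.
    have := proj_contraction (p ** x) pq; have := proj_contraction x pp; lra.
  rewrite -scalerN; apply: main.
  have -> : x *+ N - X ** x = x + \sum_(i <- r) (q ** (x - F i ** x)).
    rewrite /N mulrS XE cmul_suml -addrA; congr (_ + _).
    under [RHS]eq_bigr => i _ do rewrite cmulBr qx.
    rewrite sumrB sumr_const_seq; congr (_ - _).
    by apply: eq_bigr => i _; rewrite -!cmulA qx.
  apply: le_trans (nmD _ _) _; rewrite mulrS lerD2l.
  apply: le_trans (nm_sum _ _ _) _.
  rewrite -sumr_const_seq.
  apply: ler_sum => i _; apply: le_trans (proj_contraction _ pq) _.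
  exact: coproj_contraction.
have {w0}X0 : X = 0.
  by move/eqP: w0; rewrite scaler_eq0 => /orP[/eqP/complexI/eqP|/eqP//]; rewrite invr_eq0 gt_eqF.
apply/esym/eqP; rewrite -subr_eq0; apply/eqP/star_mul_eq0.
rewrite cstarB cstarM sp sq cmulBl !cmulBr qq !cmulA -(cmulA q p p) ppp.
rewrite subrr subr0 -opprB -/X X0 oppr0//.
Qed.
End SquareRoot.

(** * Boundedness of homomorphisms *)

Section StarHom.
Variables (R : realType) (A B : cstarAlgType R) (f : A -> B).
Hypothesis hf : star_hom f.
Implicit Types x y : A.

Lemma star_hom0 : f 0 = 0.
Proof.
have := star_hom_lin hf (-1) 0 0.
by rewrite scaler0 addr0 scaleN1r addNr.
Qed.
Lemma star_homZ a x : f (a *: x) = a *: f x.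
Proof. by rewrite -[a *: x]addr0 (star_hom_lin hf) star_hom0 addr0. Qed.
Lemma star_homD x y : f (x + y) = f x + f y.
Proof. by have := star_hom_lin hf 1 x y; rewrite !scale1r. Qed.
Lemma star_homN x : f (- x) = - f x.
Proof. by rewrite -scaleN1r star_homZ scaleN1r. Qed.
Lemma star_homB x y : f (x - y) = f x - f y.
Proof. by rewrite star_homD star_homN. Qed.
Lemma star_hom_sum (I : Type) (r : seq I) (P : pred I) (F : I -> A) :
  f (\sum_(i <- r | P i) F i) = \sum_(i <- r | P i) f (F i).
Proof. exact: (big_morph f star_homD star_hom0). Qed.

(** Scale a to norm 1/2 and let d complement it.  The relations between a and d
    survive in the image, so f a is a contraction for left multiplication;
    applied to f a itself this gives nm (f a) <= 1. *)
Lemma star_hom_bounded_self a : cstar a = a -> nm (f a) <= 2 * nm a.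
Proof.
move=> sa; have [a0|a0] := leP (nm a) 0.
  by rewrite (nm_eq0 a0) star_hom0 !nm0 mulr0.
pose c : R := (2 * nm a)^-1; have a2 : 0 < 2 * nm a by rewrite mulr_gt0.
have c0 : 0 <= c by rewrite invr_ge0 ltW.
pose x := c%:C *: a; have sx : cstar x = x by rewrite cstarZr sa.
have nx : nm x = 1 / 2.
  by rewrite nmZ_ge0// /c invfM -mulrA mulVf ?gt_eqF// mulr1 div1r.
have nxx : nm (x ** x) <= 3 / 4 by rewrite nm_self// nx expr2; lra.
have [d [sd xd dd]] := sqrt_complement sx nxx.
have sfx : cstar (f x) = f x by rewrite -(star_hom_star hf) sx.
have [h _] : nm (f x ** f x) <= nm (f x) /\ nm (f x - f d ** f x) <= nm (f x).
  apply: half_contraction => //.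
  - by rewrite -(star_hom_star hf) sd.
  - by rewrite -!(star_hom_mul hf) xd.
  - by rewrite -!(star_hom_mul hf) -!star_homD dd.
have {h} : nm (f x) <= 1.
  move: h; rewrite nm_self//; have := nm_ge0 (f x); move: (nm _) => t t0.
  have [->|tn0] := eqVneq t 0; first by rewrite ler01.
  by rewrite expr2 -{3}[t]mulr1 ler_pM2l// lt_neqAle eq_sym tn0.
by rewrite star_homZ nmZ_ge0// /c mulrC ler_pdivrMr// mul1r.
Qed.

Lemma star_hom_bounded x : nm (f x) <= 2 * nm x.
Proof.
have s : cstar (cstar x ** x) = cstar x ** x by rewrite cstarM cstarK.
have := star_hom_bounded_self s.
rewrite (star_hom_mul hf) (star_hom_star hf) !nm_star_mul.
have := nm_ge0 x; have := nm_ge0 (f x); move: (nm _) (nm _) => t u; nra.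
Qed.

Lemma star_hom_lip x y : nm (f x - f y) <= 2 * nm (x - y).
Proof. by rewrite -star_homB star_hom_bounded. Qed.
End StarHom.

Lemma star_hom_comp (R : realType) (A B C : cstarAlgType R) (f : A -> B) (g : B -> C) :
  star_hom f -> star_hom g -> star_hom (g \o f).
Proof.
move=> hf hg; split=> [a x y|x y|x] /=.
- by rewrite (star_hom_lin hf) (star_hom_lin hg).
- by rewrite (star_hom_mul hf) (star_hom_mul hg).
- by rewrite (star_hom_star hf) (star_hom_star hg).
Qed.

Lemma star_hom_id (R : realType) (A : cstarAlgType R) : star_hom (@id A).
Proof. by []. Qed.

(** * Cuntz-Krieger representations *)

Lemma edge_dir k (L : kgraph k) (e : Q L 1) : exists i, deg (val e) = basis_deg i.
Proof.
have /eqP se := size_dirs e; move: se.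
set r := [seq i <- _ | _]; case rE : r => [//|i [|//]] _; exists i; apply/ffunP => j.
have /andP[/forallP/(_ j) e1 _] := valP e; rewrite ffunE.
have : (j \in r) = (j == i) by rewrite rE inE.
by rewrite mem_filter mem_enum andbT; move: e1; case: (deg _ j) => [|[|]]//= _ <-.
Qed.

Section CKRep.
Variables (R : realType) (k : nat) (L : kgraph k) (phi : cochain L 2 (circle R)).
Hypothesis rfL : row_finite_no_sources L.

Definition edges_into (v : Q L 0) (i : 'I_k) : set (Q L 1) :=
  [set e | rng (val e) = val v /\ deg (val e) = basis_deg i].

Lemma deg_vertex (v : Q L 0) : deg (val v) = 0.
Proof.
have /andP[_ /eqP] := valP v => /eqP; rewrite sum_nat_eq0 => /forallP h.
by apply/ffunP => i; rewrite ffunE; exact/eqP/h.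
Qed.

(** Morphisms of degree 0 are identities: f = r(f) f = f s(f) are two
    factorizations of f into degrees 0 and 0. *)
Lemma rng_deg0 (f : L) : deg f = 0 -> rng f = f.
Proof.
move=> f0; have : deg f = 0 + 0 :> {ffun 'I_k -> nat} by rewrite addr0.
move=> /factorization[p [_ uniq_p]].
have e1 : p = (rng f, f) by apply: uniq_p; rewrite /= src_rng deg_rng comp_rng.
have e2 : p = (f, src f) by apply: uniq_p; rewrite /= rng_src deg_src comp_src.
by move: e2; rewrite e1 => -[].
Qed.

Lemma vrng_vertex (v : Q L 0) : vrng (val v) = v.
Proof. by apply: val_inj; rewrite /= rng_deg0// deg_vertex. Qed.

Lemma vsrc_vertex (v : Q L 0) : vsrc (val v) = v.
Proof. by rewrite -[in LHS](vrng_vertex v); apply: val_inj; rewrite /= src_rng rng_deg0 ?deg_vertex. Qed.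

Lemma edges_into_finite v i : finite_set (edges_into v i).
Proof.
have [+ _] := rfL (basis_deg i) (deg_vertex v).
move=> /(@finite_preimage _ _ _ (fun e : Q L 1 => val e)); apply.
by move=> x y _ _; exact: val_inj.
Qed.

Variables (A : cstarAlgType R) (p : Q L 0 -> A) (s : Q L 1 -> A).
Hypothesis rep : ck_rep phi p s.

Lemma ck_src e : s e ** p (vsrc (val e)) = s e.
Proof. exact: isometry_source (ck_proj rep _) (ck_TG1 rep e). Qed.

Lemma ck_edge_proj e : projection (s e ** cstar (s e)).
Proof.
split; last by rewrite cstarM cstarK.
by rewrite -cmulA (cmulA (cstar _)) (ck_TG1 rep) cmulA ck_src.
Qed.

(** s_e s_e^* is one of the projections that add up to p_(r(e)). *)
Lemma ck_rng e : p (vrng (val e)) ** s e = s e.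
Proof.
have [i ei] := edge_dir e; set v := vrng _.
have e_in : edges_into v i e by [].
have := ck_TG3 rep (v := v) (i := i) (ex_intro _ e e_in).
rewrite -/(edges_into v i) fsbig_finite; last exact: edges_into_finite.
rewrite (big_rem e)/=; last by rewrite in_fset_set ?mem_set//; exact: edges_into_finite.
move=> /(subproj_of_sum (ck_edge_proj e) (ck_proj rep v)) h.
have {}h := h (fun i => ck_edge_proj i).
by rewrite -[in LHS]ck_src -(ck_TG1 rep) !cmulA -(cmulA _ (s e)) h -cmulA (ck_TG1 rep) ck_src.
Qed.

Lemma ck_starl e : cstar (s e) = cstar (s e) ** p (vrng (val e)).
Proof. by rewrite -{1}(ck_rng e) cstarM (ck_proj rep _).2. Qed.

Lemma ck_rep_hom (B : cstarAlgType R) (f : A -> B) : star_hom f ->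
  ck_rep phi (f \o p) (f \o s).
Proof.
move=> hf; split=> /=.
- by move=> v; rewrite -(star_hom_mul hf) -(star_hom_star hf); have [-> ->] := ck_proj rep v.
- by move=> v w vw; rewrite -(star_hom_mul hf) (ck_orth rep vw) (star_hom0 hf).
- by move=> e; rewrite -(star_hom_star hf) -(star_hom_mul hf) (ck_TG1 rep).
- move=> i j mu mu' nu nu' q ij h1 h2 h3 h4 h5 h6 h7 h8.
  rewrite -!(star_hom_mul hf) -(star_homZ hf); congr f.
  exact: (ck_TG2 rep ij h1 h2 h3 h4 h5 h6 h7 h8).
- move=> v i vi; rewrite (ck_TG3 rep vi) -/(edges_into v i).
  rewrite !fsbig_finite; try exact: edges_into_finite.
  rewrite /= (star_hom_sum hf).
  by apply: eq_bigr => e _; rewrite (star_hom_mul hf) (star_hom_star hf).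
Qed.

Hypothesis tw : is_twisted_algebra phi p s.

(** Homomorphisms out of a twisted algebra are determined by the generators:
    both are the map that universality attaches to the image representation. *)
Lemma twisted_ext (B : cstarAlgType R) (f g : A -> B) : star_hom f -> star_hom g ->
  (forall v, f (p v) = g (p v)) -> (forall e, f (s e) = g (s e)) -> f =1 g.
Proof.
move=> hf hg fgp fgs x; have [u [_ uniq]] := twisted_universal tw (ck_rep_hom hf).
have <- : u = f by apply: uniq.
by have -> : u = g by apply: uniq; split=> // [v|e]; rewrite /= ?fgp ?fgs.
Qed.

(** The elements lying in S together with their adjoint form a closed
    self-adjoint subalgebra, which contains s_e = s_e p_(s(e)) and
    s_e^* = s_e^* p_(r(e)). *)
Lemma left_ideal_full (S : set A) : closed S ->
  (forall (a : R[i]) x y, S x -> S y -> S (a *: x + y)) ->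
  (forall x y, S y -> S (x ** y)) -> (forall v, S (p v)) -> forall x, S x.
Proof.
move=> clS linS idS Sp x; have [v] : inhabited (Q L 0).
  by case: (mor_inhabited L) => f; exists; exact: vrng f.
have S0 : S 0 by rewrite -(cmul0x (p v)); exact/idS.
suff [] : [set y | S y /\ S (cstar y)] x by [].
rewrite (_ : [set _ | _] = setT)//; apply: (twisted_generated tw).
split.
- apply: (@closedI _ S [set y | S (cstar y)]) => //.
  apply: (closed_preimage_lip (f := @cstar R A) (K := 1) _ clS) => y z.
  by rewrite -cstarB nm_star mul1r.
- by rewrite /= cstar0.
- move=> a y z [y1 y2] [z1 z2]; split; first exact: linS.
  by rewrite cstarD cstarZ; exact: linS.
- move=> y z [y1 y2] [z1 z2]; split; first exact: idS.
  by rewrite cstarM; exact: idS.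
- by move=> y [y1 y2]; rewrite /= cstarK.
- by move=> w; split; rewrite ?(ck_proj rep w).2.
- move=> e; split; first by rewrite -ck_src; exact: idS.
  by rewrite ck_starl; exact: idS.
Qed.
End CKRep.

(** * Faces and coboundaries *)

Section Faces.
Variables (k : nat) (L : kgraph k).

Lemma factor_unique_l (f g f' g' : L) : src f = rng g -> src f' = rng g' ->
  kcomp f g = kcomp f' g' -> deg f = deg f' -> f = f' /\ g = g'.
Proof.
move=> fg fg' e d; have dg : deg g = deg g'.
  have := deg_comp fg; rewrite e (deg_comp fg') d => /ffunP h.
  by apply/ffunP => i; have := h i; rewrite !ffunE => /addnI.
have [p [_ u]] := factorization (deg_comp fg).
have e1 : p = (f, g) by apply: u.
have : p = (f', g') by apply: u.
by rewrite e1 => -[].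
Qed.

Lemma factor_unique_r (f g f' g' : L) : src f = rng g -> src f' = rng g' ->
  kcomp f g = kcomp f' g' -> deg g = deg g' -> f = f' /\ g = g'.
Proof.
move=> fg fg' e d; apply: factor_unique_l => //.
have := deg_comp fg; rewrite e (deg_comp fg') d => /ffunP h.
by apply/ffunP => i; have := h i; rewrite !ffunE => /addIn.
Qed.

Lemma faceP r (q : Q L r.+1) j l : is_face q j l (face j l q).
Proof. exact: projT2 (cid (face_exists q j l)). Qed.

Lemma face_unique r (q : Q L r.+1) j l g : is_face q j l g -> face j l q = g.
Proof.
have := faceP q j l; move: (face j l q) => g' [h' d' e'] [h d e].
apply: val_inj; case: l e e' => -[c e] [c' e'].
  by have [] : h' = h /\ val g' = val g by apply: factor_unique_l; rewrite ?e ?d.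
by have [] : val g' = val g /\ h' = h by apply: factor_unique_r; rewrite ?e ?d.
Qed.

Lemma dirs2 (q : Q L 2) (i j : 'I_k) : (i < j)%N -> deg (val q) = basis_deg i + basis_deg j ->
  tnth (dirs q) ord0 = i /\ tnth (dirs q) ord_max = j.
Proof.
move=> ij dq.
have ltt : transitive (fun x y : 'I_k => (x < y)%N) by move=> x y z; exact: ltn_trans.
have : sorted (fun x y : 'I_k => (x < y)%N) (dirs q).
  apply: sorted_filter => //.
  have := iota_ltn_sorted 0 k; rewrite -val_enum_ord sorted_map.
  by [].
have mem x : x == i \/ x == j -> x \in tval (dirs q).
  have eij : (i == j) = false by rewrite -val_eqE /= ltn_eqF.
  by rewrite mem_filter mem_enum andbT dq !ffunE => -[]/eqP->; rewrite eqxx ?(eq_sym j) eij.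
have /(_ i (or_introl (eqxx i))) := mem; have /(_ j (or_intror (eqxx j))) := mem.
rewrite !(tnth_nth i).
have : size (dirs q) = 2 by rewrite size_tuple.
move: (tval (dirs q)) => [|x [|y []]]//= _; rewrite andbT !inE => jx ix xy.
case/orP: ix => /eqP ix; subst; case/orP: jx => /eqP jx; subst => //.
- by rewrite ltnn in ij.
- by have := ltn_trans ij xy; rewrite ltnn.
- by rewrite ltnn in ij.
Qed.

(** For q = mu nu = nu' mu', the faces of q in the smaller direction i are nu'
    and nu, and those in direction j are mu and mu'. *)
Lemma delta_square (A : zmodType) (c : cochain L 1 A) (i j : 'I_k)
  (mu mu' nu nu' : Q L 1) (q : Q L 2) : (i < j)%N ->
  deg (val mu) = basis_deg i -> deg (val mu') = basis_deg i ->
  deg (val nu) = basis_deg j -> deg (val nu') = basis_deg j ->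
  src (val mu) = rng (val nu) -> src (val nu') = rng (val mu') ->
  kcomp (val mu) (val nu) = val q -> kcomp (val nu') (val mu') = val q ->
  delta c q = c mu + c nu - (c mu' + c nu').
Proof.
move=> ij dm dm' dn dn' mn nm' mnq nmq.
have dq : deg (val q) = basis_deg i + basis_deg j by rewrite -mnq deg_comp// dm dn.
have [d0 d1] := dirs2 ij dq.
rewrite /delta big_ord_recl big_ord1 !big_bool /=.
have -> : lift ord0 ord0 = ord_max :> 'I_2 by apply: val_inj.
rewrite (@face_unique _ q ord0 true nu); last by exists (val mu); rewrite ?d0.
rewrite (@face_unique _ q ord0 false nu'); last by exists (val mu'); rewrite ?d0.
rewrite (@face_unique _ q ord_max true mu'); last by exists (val nu'); rewrite ?d1.
rewrite (@face_unique _ q ord_max false mu); last by exists (val nu); rewrite ?d1.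
rewrite (_ : (-1) ^+ (1 + 1) = 1)// (_ : (-1) ^+ (1 + 0) = -1)//.
rewrite (_ : (-1) ^+ ((bump 0 0).+1 + 1) = -1)//.
by rewrite !mulrN1z !mulr1z; zmod.
Qed.

End Faces.

Section Automorphisms.
Variables (k : nat) (L : kgraph k).
Implicit Types b : kaut L.

Definition kaut_sym b : kaut L.
Proof.
refine (@KAut k L (kaut_inv b) b (kaut_invK b) (kaut_funK b) (kinv_rng b) (kinv_src b) _ _).
- move=> f g fg; apply: (can_inj (kaut_funK b)).
  by rewrite kaut_comp ?kaut_invK// kinv_src kinv_rng fg.
- by move=> f; rewrite -{2}(kaut_invK b f) kaut_deg.
Defined.

Lemma cube_autK b r : cancel (@cube_aut k L b r) (cube_aut (kaut_sym b) (r := r)).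
Proof. by move=> q; apply: val_inj; exact: kaut_funK. Qed.
Lemma cube_autVK b r : cancel (cube_aut (kaut_sym b) (r := r)) (@cube_aut k L b r).
Proof. by move=> q; apply: val_inj; exact: kaut_invK. Qed.

Lemma dirs_aut b r (q : Q L r) : dirs (cube_aut b q) = dirs q.
Proof. by apply: val_inj; apply: eq_filter => i; rewrite /= kaut_deg. Qed.

Lemma face_aut b r (q : Q L r.+1) j l : face j l (cube_aut b q) = cube_aut b (face j l q).
Proof.
apply: face_unique; have [h dh hq] := faceP q j l; exists (b h).
  by rewrite kaut_deg dirs_aut.
by case: l hq => -[h1 h2]; split; rewrite /= -?kaut_comp ?h2// kaut_src kaut_rng h1.
Qed.

Lemma delta_pullback b r (A : zmodType) (f : cochain L r A) :
  delta (pullback b f) = pullback b (delta f).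
Proof.
apply/funext => q; rewrite /delta /pullback; apply: eq_bigr => j _; apply: eq_bigr => l _.
by rewrite face_aut.
Qed.

Lemma vsrc_aut b f : vsrc (b f) = cube_aut b (vsrc f).
Proof. by apply: val_inj; rewrite /= kaut_src. Qed.
Lemma vrng_aut b f : vrng (b f) = cube_aut b (vrng f).
Proof. by apply: val_inj; rewrite /= kaut_rng. Qed.

End Automorphisms.

Lemma deltaN k (L : kgraph k) r (A : zmodType) (f : cochain L r A) :
  delta (fun q => - f q) = fun q => - delta f q.
Proof.
apply/funext => q; rewrite /delta -sumrN; apply: eq_bigr => j _; rewrite -sumrN.
by apply: eq_bigr => l _; rewrite mulNrz.
Qed.

(** * Cubes of the crossed product graph *)

Section CrossedCubes.
Variables (k : nat) (L : kgraph k) (b : kaut L).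
Local Notation G := (cpgraph b).
Local Notation up := (lift (@ord_max k)).

Lemma cp_degree_up (f : L) n i : deg ((f, n) : G) (up i) = deg f i.
Proof. by rewrite /= ffunE liftK. Qed.
Lemma cp_degree_max (f : L) n : deg ((f, n) : G) ord_max = n.
Proof. by rewrite /= ffunE unlift_none. Qed.

Lemma widen_up (i : 'I_k) : widen_ord (leqnSn k) i = up i.
Proof. by apply: val_inj; exact/esym/lift_max. Qed.

Lemma basis_up (i : 'I_k) f : deg f = basis_deg i -> deg ((f, 0%N) : G) = basis_deg (up i).
Proof.
move=> df; apply/ffunP => a; rewrite /= !ffunE /= df; case: unliftP => [c ->|->].
  by rewrite ffunE (inj_eq lift_inj).
by rewrite eq_sym lift_eqF.
Qed.

Lemma basis_max f : deg f = 0 -> deg ((f, 1%N) : G) = basis_deg ord_max.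
Proof.
move=> df; apply/ffunP => a; rewrite /= !ffunE /= df; case: unliftP => [c ->|->].
  by rewrite ffunE lift_eqF.
by rewrite eqxx.
Qed.

Lemma is_cube_cpE r (f : L) n : is_cube r ((f, n) : G) ->
  [/\ (n <= 1)%N, (forall i, deg f i <= 1)%N & (\sum_i deg f i + n)%N = r].
Proof.
move=> /andP[/forallP h /eqP <-]; split.
- by have := h ord_max; rewrite cp_degree_max.
- by move=> i; have := h (up i); rewrite cp_degree_up.
- rewrite big_ord_recr cp_degree_max; congr (_ + _)%N.
  by apply: eq_bigr => i _; rewrite widen_up cp_degree_up.
Qed.

(** Informative, so that functions on cubes can be defined by cases. *)
Lemma cubeP r (q : Q G r.+1) :
  {q' : Q L r.+1 | base_cube b q' = q} + {q' : Q L r | prism_cube b q' = q}.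
Proof.
case: q => -[f [|[|n]]] fc.
- left; have [_ f1 fr] := is_cube_cpE fc.
  have f' : is_cube r.+1 f.
    by apply/andP; split; [exact/forallP|rewrite -fr addn0].
  by exists (exist _ f f'); exact: val_inj.
- right; have [_ f1 fr] := is_cube_cpE fc.
  have f' : is_cube r f.
    by apply/andP; split; [exact/forallP|move: fr; rewrite addn1 => -[->]].
  by exists (exist _ f f'); exact: val_inj.
- by exfalso; have [] := is_cube_cpE fc.
Qed.

Lemma vertexP (q : Q G 0) : {v : Q L 0 | base_cube b v = q}.
Proof.
case: q => -[f n] fc; have [_ f1 fr] := is_cube_cpE fc.
have n0 : n = 0%N by move/eqP: fr; rewrite addn_eq0 => /andP[_ /eqP].
have f' : is_cube 0 f.
  by apply/andP; split; [exact/forallP|move/eqP: fr; rewrite addn_eq0 => /andP[]].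
by exists (exist _ f f'); apply: val_inj; rewrite /= n0.
Qed.

Lemma base_cube_inj r : injective (@base_cube k L b r).
Proof. by move=> x y /(congr1 val)[/val_inj]. Qed.
Lemma prism_cube_inj r : injective (@prism_cube k L b r).
Proof. by move=> x y /(congr1 val)[/val_inj]. Qed.

Definition cube_case r (T : Type) (f : Q L r.+1 -> T) (g : Q L r -> T) (q : Q G r.+1) : T :=
  match cubeP q with inl (exist x _) => f x | inr (exist x _) => g x end.

Lemma cube_case_base r T (f : Q L r.+1 -> T) (g : Q L r -> T) q :
  cube_case f g (base_cube b q) = f q.
Proof.
rewrite /cube_case; case: cubeP => -[x xq]; first by rewrite (base_cube_inj xq).
by have := congr1 val xq.
Qed.

Lemma cube_case_prism r T (f : Q L r.+1 -> T) (g : Q L r -> T) q :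
  cube_case f g (prism_cube b q) = g q.
Proof.
rewrite /cube_case; case: cubeP => -[x xq]; last by rewrite (prism_cube_inj xq).
by have := congr1 val xq.
Qed.

Lemma dirs_base r (q : Q L r) : val (dirs (base_cube b q)) = [seq up i | i <- dirs q].
Proof.
rewrite /= enum_ordSr filter_rcons cp_degree_max/= filter_map.
have -> : map (widen_ord (leqnSn k)) =1 map up by apply: eq_map; exact: widen_up.
by congr map; apply: eq_filter => i /=; rewrite widen_up cp_degree_up.
Qed.

Lemma dirs_prism r (q : Q L r) :
  val (dirs (prism_cube b q)) = rcons [seq up i | i <- dirs q] ord_max.
Proof.
rewrite /= enum_ordSr filter_rcons cp_degree_max/= filter_map.
have -> : map (widen_ord (leqnSn k)) =1 map up by apply: eq_map; exact: widen_up.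
by congr (rcons (map _ _) _); apply: eq_filter => i /=; rewrite widen_up cp_degree_up.
Qed.

Lemma tnth_dirs_base r (q : Q L r) j : tnth (dirs (base_cube b q)) j = up (tnth (dirs q) j).
Proof.
rewrite (tnth_nth ord_max) dirs_base (tnth_nth (tnth (dirs q) j)).
by rewrite (nth_map (tnth (dirs q) j)) ?size_tuple.
Qed.

Lemma tnth_dirs_prism r (q : Q L r) (j : 'I_r) :
  tnth (dirs (prism_cube b q)) (widen_ord (leqnSn r) j) = up (tnth (dirs q) j).
Proof.
rewrite (tnth_nth ord_max) dirs_prism (tnth_nth (tnth (dirs q) j)) nth_rcons.
rewrite size_map size_tuple [(_ < _)%N](ltn_ord j).
by rewrite (nth_map (tnth (dirs q) j)) ?size_tuple //; exact: (ltn_ord j).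
Qed.

Lemma tnth_dirs_prism_max r (q : Q L r) : tnth (dirs (prism_cube b q)) ord_max = ord_max.
Proof.
by rewrite (tnth_nth ord_max) dirs_prism nth_rcons size_map size_tuple ltnn eqxx.
Qed.

Lemma face_base r (q : Q L r.+1) j l :
  face j l (base_cube b q) = base_cube b (face j l q).
Proof.
apply: face_unique; have [h dh hq] := faceP q j l.
exists (h, 0%N); first by rewrite tnth_dirs_base; exact: basis_up.
case: l hq => -[h1 h2]; split; do ?exact/cp_composable.
  by rewrite /= /cp_comp /= h2.
by rewrite /= /cp_comp /= h2.
Qed.

(** For the front face the removed edge sits behind the step in the new
    direction, where it appears transported by the inverse of b. *)
Lemma face_prism r (q : Q L r.+1) (j : 'I_r.+1) l :
  face (widen_ord (leqnSn r.+1) j) l (prism_cube b q) = prism_cube b (face j l q).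
Proof.
apply: face_unique; have [h dh hq] := faceP q j l; case: l hq => -[h1 h2].
  exists (h, 0%N); first by rewrite tnth_dirs_prism; exact: basis_up.
  by split; [exact/cp_composable|rewrite /= /cp_comp /= h2].
exists (kaut_inv b h, 0%N).
  by rewrite tnth_dirs_prism; apply: basis_up; rewrite -(kaut_deg b) kaut_invK.
by split; [apply/cp_composable; rewrite /= kaut_invK|rewrite /= /cp_comp /= kaut_invK h2].
Qed.

Lemma face_prism_top r (q : Q L r.+1) :
  face ord_max false (prism_cube b q) = base_cube b q.
Proof.
apply: face_unique; exists (src (val q), 1%N).
  by rewrite tnth_dirs_prism_max; apply: basis_max; exact: deg_src.
by split; [apply/cp_composable; rewrite /= rng_src|rewrite /= /cp_comp /= comp_src].
Qed.

Lemma face_prism_bottom r (q : Q L r.+1) :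
  face ord_max true (prism_cube b q) = base_cube b (cube_aut (kaut_sym b) q).
Proof.
apply: face_unique; exists (rng (val q), 1%N).
  by rewrite tnth_dirs_prism_max; apply: basis_max; exact: deg_rng.
split; first by apply/cp_composable; rewrite /= kaut_invK src_rng.
by rewrite /= /cp_comp /= kaut_invK comp_rng.
Qed.

(** On a prism over x, the two faces in the new direction contribute
    psi(b^-1 x) - psi(x), which the faces in the old directions cancel. *)
Lemma cocycle_cube_case (A : zmodType) (psi : cochain L 2 A) (c : cochain L 1 A) :
  cocycle psi -> (forall q, psi q - psi (cube_aut b q) = delta c q) ->
  cocycle (cube_case psi (fun e => - c (cube_aut (kaut_sym b) e)) : cochain G 2 A).
Proof.
move=> psi0 psic q; have [[x <-]|[x <-]] := cubeP q.
  rewrite -[RHS](psi0 x); apply: eq_bigr => j _; apply: eq_bigr => l _.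
  by rewrite face_base cube_case_base.
rewrite /delta big_ord_recr /=.
under eq_bigr => j _ do under eq_bigr => l _ do rewrite face_prism cube_case_prism.
rewrite big_bool face_prism_top face_prism_bottom !cube_case_base.
have := deltaN (pullback (kaut_sym b) c); rewrite delta_pullback => /(congr1 (fun f => f x)).
rewrite /pullback -psic cube_autVK /delta => ->.
rewrite (_ : (-1) ^+ (3 + true) = 1)// (_ : (-1) ^+ (3 + false) = -1)//.
by rewrite mulrN1z mulr1z /=; zmod.
Qed.

End CrossedCubes.

(** * The automorphism of the twisted algebra *)

Section TwistedAutomorphism.
Variables (R : realType) (k : nat) (L : kgraph k) (psi : cochain L 2 (circle R)).
Hypothesis rfL : row_finite_no_sources L.
Variables (A : cstarAlgType R) (p : Q L 0 -> A) (s : Q L 1 -> A).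

Lemma circle_valD (z w : circle R) : val (z + w) = val z * val w.
Proof. by []. Qed.

Lemma circle_conj_mul (z : circle R) : ((val z)^*)%R * val z = 1.
Proof. by rewrite mulrC -normCK (eqP (valP z)) expr1n. Qed.

Lemma circle_scaleA (z w : circle R) (x : A) : val z *: (val w *: x) = val (z + w) *: x.
Proof. by rewrite scalerA. Qed.

Lemma circle_star_mul (z : circle R) (x : A) :
  cstar (val z *: x) ** (val z *: x) = cstar x ** x.
Proof. by rewrite cstarZ cmulZl cmulZr scalerA circle_conj_mul scale1r. Qed.

Lemma circle_mul_star (z : circle R) (x : A) :
  (val z *: x) ** cstar (val z *: x) = x ** cstar x.
Proof. by rewrite cstarZ cmulZl cmulZr scalerA mulrC circle_conj_mul scale1r. Qed.

Lemma edges_into_aut (b : kaut L) v i :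
  set_bij (edges_into v i) (edges_into (cube_aut b v) i) (cube_aut b (r := 1)).
Proof.
split=> [e [re de]|x y _ _|e [re de]] /=.
- by split; rewrite /= ?kaut_deg// kaut_rng re.
- exact: (can_inj (cube_autK b (r := 1))).
- exists (cube_aut (kaut_sym b) e); last exact: cube_autVK.
  by split; rewrite /= ?kinv_rng ?re/= ?kaut_funK//; have := kaut_deg (kaut_sym b) (val e); rewrite /= => ->.
Qed.

(** The scalars -c compensate exactly for the difference of psi and its
    pullback on each square ([delta_square]). *)
Lemma twisted_rep_aut (b : kaut L) (c : cochain L 1 (circle R)) :
  (forall q, psi q - psi (cube_aut b q) = delta c q) -> ck_rep psi p s ->
  ck_rep psi (fun v => p (cube_aut b v)) (fun e => val (- c e) *: s (cube_aut b e)).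
Proof.
move=> psic rep; split.
- by move=> v; exact: (ck_proj rep).
- move=> v w vw; apply: (ck_orth rep) => bvw; apply: vw.
  exact: (can_inj (cube_autK b (r := 0)) bvw).
- by move=> e; rewrite circle_star_mul (ck_TG1 rep) /= vsrc_aut.
- move=> i j mu mu' nu nu' q ij dm dm' dn dn' mn nm' mnq nmq.
  have h := @ck_TG2 _ _ _ _ _ _ _ rep i j (cube_aut b mu) (cube_aut b mu') (cube_aut b nu)
    (cube_aut b nu') (cube_aut b q) ij.
  rewrite [val _]/= ![val (cube_aut _ _)]/= !kaut_deg !kaut_src !kaut_rng mn nm' in h.
  rewrite -!kaut_comp// mnq nmq in h.
  move: h => /(_ dm dm' dn dn' erefl erefl erefl erefl) h.
  rewrite !cmulZl !cmulZr h !circle_scaleA.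
  congr (val _ *: _); have := delta_square c ij dm dm' dn dn' mn nm' mnq nmq.
  rewrite -psic => /eqP; rewrite subr_eq => /eqP ->.
  by zmod.
- move=> v i vLi vi; rewrite /vLi -/(edges_into v i).
  have ne : edges_into (cube_aut b v) i !=set0.
    by case: vi => e [re de]; exists (cube_aut b e); split; rewrite /= ?kaut_deg// kaut_rng re.
  rewrite (ck_TG3 rep ne) -/(edges_into _ i) (reindex_fsbig _ _ _ _ (edges_into_aut b v i)).
  by apply: eq_fsbigr => e _; rewrite circle_mul_star.
Qed.

(** The inverse comes from b^-1 with the cochain -c(b^-1 e), which cobounds
    psi - (b^-1)^* psi. *)
Lemma twisted_automorphism (b : kaut L) (c : cochain L 1 (circle R)) :
  (forall q, psi q - psi (cube_aut b q) = delta c q) -> is_twisted_algebra psi p s ->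
  exists beta : star_aut A, (forall v, beta (p v) = p (cube_aut b v)) /\
    (forall e, beta (s e) = val (- c e) *: s (cube_aut b e)).
Proof.
move=> psic tw; have rep := twisted_rep tw.
pose c' : cochain L 1 (circle R) := fun e => - c (cube_aut (kaut_sym b) e).
have psic' q : psi q - psi (cube_aut (kaut_sym b) q) = delta c' q.
  have := deltaN (pullback (kaut_sym b) c); rewrite delta_pullback => /(congr1 (fun f => f q)).
  by rewrite /pullback -psic cube_autVK /c' => ->; rewrite opprB.
have [f [[hf fp fs] _]] := twisted_universal tw (twisted_rep_aut psic rep).
have [g [[hg gp gs] _]] := twisted_universal tw (twisted_rep_aut psic' rep).
have fgK : cancel f g.
  apply: (twisted_ext rfL rep tw (star_hom_comp hf hg) (star_hom_id A)) => [v|e] /=.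
    by rewrite fp gp cube_autK.
  rewrite fs (star_homZ hg) gs scalerA -circle_valD /c' opprK cube_autK addNr.
  by rewrite scale1r.
have gfK : cancel g f.
  apply: (twisted_ext rfL rep tw (star_hom_comp hg hf) (star_hom_id A)) => [v|e] /=.
    by rewrite gp fp cube_autVK.
  rewrite gs (star_homZ hf) fs scalerA -circle_valD /c' opprK cube_autVK subrr.
  by rewrite scale1r.
by exists (StarAut hf fgK gfK).
Qed.
End TwistedAutomorphism.

(** * Unitary right multipliers *)

Section LeftModuleMaps.
Variables (R : realType) (B : cstarAlgType R).

(** Maps commuting with left multiplications, such as x |-> x U for a multiplier
    U.  Two of them agree as soon as they agree on elements generating the
    algebra as a closed left ideal ([lmm_ext]). *)
Record left_module_map (f : B -> B) : Prop := LeftModuleMap {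
  lmm_lin : forall (a : R[i]) x y, f (a *: x + y) = a *: f x + f y;
  lmm_mul : forall x y, f (x ** y) = x ** f y;
  lmm_bound : exists K : R, forall x, nm (f x) <= K * nm x
}.

Lemma lmm_id : left_module_map id.
Proof. by split=> //; exists 1 => x; rewrite mul1r. Qed.

Lemma lmm_mulr y : left_module_map (fun x => x ** y).
Proof.
split=> [a x z|x z|]; rewrite ?cmulDl ?cmulZl ?cmulA//.
by exists (nm y) => x; rewrite mulrC nmM.
Qed.

Lemma lmm_comp f g : left_module_map f -> left_module_map g -> left_module_map (f \o g).
Proof.
move=> hf hg; split=> [a x y|x y|] /=.
- by rewrite (lmm_lin hg) (lmm_lin hf).
- by rewrite (lmm_mul hg) (lmm_mul hf).
have [K fK] := lmm_bound hf; have [K' gK] := lmm_bound hg; exists (`|K| * K') => x.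
apply: le_trans (fK _) _; apply: le_trans (ler_wpM2r (nm_ge0 _) (ler_norm K)) _.
by rewrite -mulrA ler_wpM2l.
Qed.

Lemma lmm_iter n f : left_module_map f -> left_module_map (iter n f).
Proof. by move=> hf; elim: n => [|n IH]; [exact: lmm_id|exact: lmm_comp hf IH]. Qed.

Lemma lmm_sub f : left_module_map f -> forall x y, f (x - y) = f x - f y.
Proof.
move=> hf x y; rewrite addrC -scaleN1r (lmm_lin hf) addrC.
by rewrite scaleN1r.
Qed.

Lemma lmmZ f : left_module_map f -> forall a x, f (a *: x) = a *: f x.
Proof.
move=> hf a x; have f0 : f 0 = 0 by rewrite -[X in f X](subrr x) lmm_sub// subrr.
by rewrite -[a *: x]addr0 (lmm_lin hf) f0 addr0.
Qed.

Lemma closed_eq_lip (A D : cstarAlgType R) (f g : A -> D) (K K' : R) :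
  (forall x y, nm (f x - f y) <= K * nm (x - y)) ->
  (forall x y, nm (g x - g y) <= K' * nm (x - y)) -> closed [set x | f x = g x].
Proof.
move=> fK gK; apply/closed_nmP => x hx.
apply/eqP; rewrite -subr_eq0; apply/eqP/nm_eq0.
rewrite leNgt; apply/negP => d0; pose M := `|K| + `|K'| + 1.
have M0 : 0 < M by rewrite ltr_wpDl// addr_ge0.
have [y fgy] := hx _ (divr_gt0 d0 M0); rewrite ltr_pdivlMr//.
have := nm_triangle (f y) (f x) (g x); rewrite {2}fgy (nmBC (g y)).
have := fK x y; have := gK x y; rewrite /M.
have := ler_wpM2r (nm_ge0 (x - y)) (ler_norm K).
have := ler_wpM2r (nm_ge0 (x - y)) (ler_norm K').
have := nm_ge0 (x - y); rewrite !mulrDr mulr1 ![nm (x - y) * _]mulrC; lra.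
Qed.

Lemma lmm_lip f : left_module_map f -> exists K : R, forall x y, nm (f x - f y) <= K * nm (x - y).
Proof. by move=> hf; have [K fK] := lmm_bound hf; exists K => x y; rewrite -lmm_sub. Qed.

End LeftModuleMaps.

(** Partial isometries e_v with mutually orthogonal range projections q_v and
    source projections q_(sigma v).  Their sum over all v is in general only a
    multiplier. *)
Section Multiplier.
Variables (R : realType) (B : cstarAlgType R) (V : countType).
Variables (q : V -> B) (e : V -> B) (sigma : V -> V).
Hypothesis q_proj : forall v, projection (q v).
Hypothesis q_orth : forall v w, v <> w -> q v ** q w = 0.
Hypothesis q_full : forall S : set B, closed S ->
  (forall (a : R[i]) x y, S x -> S y -> S (a *: x + y)) ->
  (forall x y, S y -> S (x ** y)) -> (forall v, S (q v)) -> forall x, S x.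

Lemma lmm_ext (f g : B -> B) : left_module_map f -> left_module_map g ->
  (forall v, f (q v) = g (q v)) -> f =1 g.
Proof.
move=> hf hg fg; apply: (q_full (S := [set x | f x = g x])) => //.
- have [K fK] := lmm_lip hf; have [K' gK] := lmm_lip hg; exact: closed_eq_lip fK gK.
- by move=> a x y /= fx fy; rewrite (lmm_lin hf) (lmm_lin hg) fx fy.
- by move=> x y /= fy; rewrite (lmm_mul hf) (lmm_mul hg) fy.
Qed.

Hypothesis sigma_inj : injective sigma.
Hypothesis e_src : forall v, cstar (e v) ** e v = q (sigma v).
Hypothesis e_rng : forall v, e v ** cstar (e v) = q v.

Lemma partial_isometry_src v : e v ** q (sigma v) = e v.
Proof. exact: isometry_source (q_proj _) (e_src v). Qed.

Lemma partial_isometry_rng v : q v ** e v = e v.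
Proof. by rewrite -e_rng -cmulA e_src partial_isometry_src. Qed.

Lemma partial_isometry_orth v w : v <> w -> e v ** cstar (e w) = 0.
Proof.
move=> vw; rewrite -(partial_isometry_src v) -(partial_isometry_src w) cstarM (q_proj _).2.
rewrite -cmulA (cmulA (q _) (q _)) q_orth ?cmul0x ?cmulx0//.
by move=> /sigma_inj.
Qed.

Definition enum_fam (f : V -> B) (i : nat) : B :=
  if pickle_inv i is Some v then f v else 0.
Definition partial (f : V -> B) (n : nat) : B := \sum_(i < n) enum_fam f i.

(** [pickle_inv] rather than [unpickle], so that each index set element is
    enumerated once. *)
Lemma pickle_inv_inj i j (v : V) : pickle_inv i = Some v -> pickle_inv j = Some v -> i = j.
Proof.
by move=> iv jv; have := @pickle_invK V i; have := @pickle_invK V j; rewrite iv jv /= => <- <-.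
Qed.

Lemma partial_mul (f g h : V -> B) n :
  (forall v, f v ** g v = h v) -> (forall v w, v <> w -> f v ** g w = 0) ->
  partial f n ** partial g n = partial h n.
Proof.
move=> fgh fg0; have famM i j : enum_fam f i ** enum_fam g j =
    if i == j then enum_fam h i else 0.
  rewrite /enum_fam; case iv: (pickle_inv i) => [v|]; last by rewrite cmul0x if_same.
  case jw: (pickle_inv j) => [w|]; last first.
    by rewrite cmulx0; case: eqVneq => // ij; rewrite ij jw in iv.
  case: eqVneq => [ij|ij].
    by move: iv; rewrite ij jw => -[->].
  apply: fg0 => vw; move/eqP: ij; apply; apply: pickle_inv_inj iv _.
  by rewrite vw.
rewrite /partial cmul_suml; apply: eq_bigr => i _.
rewrite cmul_sumr (bigD1 i)//= famM eqxx big1 ?addr0// => j ji.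
by rewrite famM eq_sym (inj_eq val_inj) (negPf ji).
Qed.

Lemma partial_star (f : V -> B) n : cstar (partial f n) = partial (fun v => cstar (f v)) n.
Proof.
rewrite cstar_sum; apply: eq_bigr => i _; rewrite /enum_fam.
by case: pickle_inv => // ; rewrite cstar0.
Qed.

Lemma partial_mul_star n : partial e n ** cstar (partial e n) = partial q n.
Proof. by rewrite partial_star; apply: partial_mul => // v w /partial_isometry_orth. Qed.

Lemma partial_proj n : projection (partial q n).
Proof.
split; first by apply: partial_mul => // v; exact: (q_proj v).1.
by rewrite partial_star; congr partial; apply/funext => v; exact: (q_proj v).2.
Qed.

(** The partial sums U_n satisfy U_n U_n^* = P_n, a projection. *)
Lemma nm_partial n : nm (partial e n) <= 1.
Proof.
have le1 (t : R) : 0 <= t -> t ^+ 2 <= t -> t <= 1.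
  move=> t0; have [->|tn0] := eqVneq t 0; first by rewrite ler01.
  by rewrite expr2 -{3}[t]mulr1 ler_pM2l// lt_neqAle eq_sym tn0.
have : nm (partial q n) <= 1.
  apply: le1 (nm_ge0 _) _; rewrite -nm_self ?(partial_proj n).2//.
  by rewrite (partial_proj n).1.
rewrite -partial_mul_star nm_mul_star; have := nm_ge0 (partial e n).
by move: (nm _) => t; nra.
Qed.

Lemma nm_mul_partial x n : nm (x ** partial e n) <= nm x.
Proof.
apply: le_trans (nmM _ _) _; rewrite -[leRHS]mulr1.
by rewrite ler_wpM2l ?nm_ge0// nm_partial.
Qed.

Lemma q_partial v n : (pickle v < n)%N -> q v ** partial e n = e v.
Proof.
move=> vn; rewrite cmul_sumr (bigD1 (Ordinal vn))//= /enum_fam pickleK_inv partial_isometry_rng.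
rewrite big1 ?addr0// => i; rewrite -val_eqE /= => iv.
case wi: (pickle_inv i) => [w|]; last by rewrite cmulx0.
rewrite -partial_isometry_rng cmulA q_orth ?cmul0x// => vw; move/eqP: iv; apply.
by apply: pickle_inv_inj wi _; rewrite -vw pickleK_inv.
Qed.

(** The x with convergent x U_n form a left ideal, closed since the U_n are
    contractions; on q_v the sequence is eventually constant. *)
Lemma mul_partial_cvg x : exists l, tends (fun n => x ** partial e n) l.
Proof.
move: x; apply: (q_full (S := [set x | exists l, tends (fun n => x ** partial e n) l])).
- apply/closed_nmP => x hx; apply: tends_cauchy => d d0.
  have d4 : 0 < d / 4 by rewrite divr_gt0.
  have [y [l yl] xy] := hx _ d4; have [N hN] := yl _ d4; exists N => n /hN h1.
  have h2 := hN N (leqnn N).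
  have h3 := nm_mul_partial (x - y) n; have h4 := nm_mul_partial (x - y) N.
  rewrite cmulBl in h3; rewrite cmulBl in h4.
  have := nm_triangle (y ** partial e n) (x ** partial e n) (x ** partial e N).
  have := nm_triangle l (y ** partial e n) (x ** partial e N).
  have := nm_triangle (y ** partial e N) l (x ** partial e N).
  rewrite (nmBC l (y ** partial e N)) (nmBC (y ** partial e N) (x ** partial e N)); lra.
- move=> a x y [l xl] [m ym]; exists (a *: l + m).
  have -> : (fun n => (a *: x + y) ** partial e n) =
      (fun n => a *: (x ** partial e n) + y ** partial e n).
    by apply/funext => n; rewrite cmulDl cmulZl.
  apply: tendsD ym; apply: (tends_lip (f := fun x => a *: x) (K := complex.Re `|a|) _ xl).
  by move=> u v; rewrite -scalerBr nmZ.
- move=> x y [l yl]; exists (x ** l).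
  have -> : (fun n => (x ** y) ** partial e n) = (fun n => x ** (y ** partial e n)).
    by apply/funext => n; rewrite cmulA.
  apply: (tends_lip (f := fun y => x ** y) (K := nm x) _ yl).
  by move=> u v; rewrite -cmulBr nmM.
- by move=> v; exists (e v); apply: (@tends_eventually _ _ _ _ (pickle v).+1) => n; exact: q_partial.
Qed.

Definition right_mul x : B := projT1 (cid (mul_partial_cvg x)).

Lemma right_mulP x : tends (fun n => x ** partial e n) (right_mul x).
Proof. exact: projT2 (cid (mul_partial_cvg x)). Qed.

Lemma right_mul_lmm : left_module_map right_mul.
Proof.
split=> [a x y|x y|].
- apply: tends_unique (right_mulP _) _.
  have -> : (fun n => (a *: x + y) ** partial e n) =
      (fun n => a *: (x ** partial e n) + y ** partial e n).
    by apply/funext => n; rewrite cmulDl cmulZl.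
  apply: tendsD (right_mulP y).
  apply: (tends_lip (f := fun x => a *: x) (K := complex.Re `|a|) _ (right_mulP x)).
  by move=> u v; rewrite -scalerBr nmZ.
- apply: tends_unique (right_mulP _) _.
  have -> : (fun n => (x ** y) ** partial e n) = (fun n => x ** (y ** partial e n)).
    by apply/funext => n; rewrite cmulA.
  apply: (tends_lip (f := fun y => x ** y) (K := nm x) _ (right_mulP y)).
  by move=> u v; rewrite -cmulBr nmM.
- exists 1 => x; rewrite mul1r; apply: tends_nm_le (right_mulP x) _ => n.
  exact: nm_mul_partial.
Qed.

Lemma right_mul_q v : right_mul (q v) = e v.
Proof.
apply: tends_unique (right_mulP _) _.
by apply: (@tends_eventually _ _ _ _ (pickle v).+1) => n; exact: q_partial.
Qed.

(** U U^* = 1, tested first against y = q_v and then against all x. *)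
Lemma right_mul_inner x y : right_mul x ** cstar (right_mul y) = x ** cstar y.
Proof.
have inner_e v z : right_mul z ** cstar (e v) = z ** q v.
  apply: (@lmm_ext (fun z => right_mul z ** cstar (e v)) (fun z => z ** q v)) => [||w].
  - exact: lmm_comp (lmm_mulr _) right_mul_lmm.
  - exact: lmm_mulr.
  rewrite right_mul_q; have [->|/eqP wv] := eqVneq w v; first by rewrite e_rng (q_proj _).1.
  by rewrite partial_isometry_orth// q_orth.
apply: (@lmm_ext (fun x => right_mul x ** cstar (right_mul y)) (fun x => x ** cstar y)) => [||v].
- exact: lmm_comp (lmm_mulr _) right_mul_lmm.
- exact: lmm_mulr.
rewrite right_mul_q; apply: (can_inj (@cstarK R B)).
by rewrite !cstarM !cstarK inner_e (q_proj v).2.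
Qed.

End Multiplier.

(** f and g are right multiplication by a unitary multiplier and by its
    adjoint; [ru_inner] expresses unitarity inside the algebra. *)
Record right_unitary (R : realType) (B : cstarAlgType R) (f g : B -> B) : Prop := RightUnitary {
  ru_lmm : left_module_map f;
  ru_lmm_inv : left_module_map g;
  ru_K : cancel f g;
  ru_VK : cancel g f;
  ru_inner : forall x y, f x ** cstar (f y) = x ** cstar y
}.

(** The adjoint is built in the same way from the family e_(tau v)^*. *)
Lemma right_unitary_exists (R : realType) (B : cstarAlgType R) (V : countType)
    (q e : V -> B) (sigma tau : V -> V) :
  (forall v, projection (q v)) -> (forall v w, v <> w -> q v ** q w = 0) ->
  (forall S : set B, closed S ->
    (forall (a : R[i]) x y, S x -> S y -> S (a *: x + y)) ->
    (forall x y, S y -> S (x ** y)) -> (forall v, S (q v)) -> forall x, S x) ->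
  cancel sigma tau -> cancel tau sigma ->
  (forall v, cstar (e v) ** e v = q (sigma v)) -> (forall v, e v ** cstar (e v) = q v) ->
  exists f g : B -> B, right_unitary f g /\ forall v, f (q v) = e v.
Proof.
move=> qp qo qf sK tK es er.
pose e' v := cstar (e (tau v)).
have es' v : cstar (e' v) ** e' v = q (tau v) by rewrite /e' cstarK er.
have er' v : e' v ** cstar (e' v) = q v by rewrite /e' cstarK es tK.
pose f := right_mul qp qo qf (can_inj sK) es er.
pose g := right_mul qp qo qf (can_inj tK) es' er'.
have hf : left_module_map f := right_mul_lmm qp qo qf (can_inj sK) es er.
have hg : left_module_map g := right_mul_lmm qp qo qf (can_inj tK) es' er'.
have fq v : f (q v) = e v := right_mul_q qp qo qf (can_inj sK) es er v.
have gq v : g (q v) = e' v := right_mul_q qp qo qf (can_inj tK) es' er' v.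
exists f, g; split=> //; split=> //.
- apply: (lmm_ext qf (lmm_comp hg hf) (lmm_id B)) => v /=.
  rewrite fq -(partial_isometry_src qp es v) (lmm_mul hg) gq /e' sK; exact: er.
- apply: (lmm_ext qf (lmm_comp hf hg) (lmm_id B)) => v /=.
  rewrite gq -(partial_isometry_src qp es' v) (lmm_mul hf) fq /e' es tK; by [].
- exact: (right_mul_inner qp qo qf (can_inj sK) es er).
Qed.

(** * Finitely supported functions on the integers *)

Section IntegerIterates.
Variables (T : Type) (f g : T -> T).
Hypotheses (fK : cancel f g) (gK : cancel g f).

Definition zpow (n : int) : T -> T :=
  match n with Posz m => iter m f | Negz m => iter m.+1 g end.

Lemma zpow_succ n x : zpow (n + 1) x = f (zpow n x).
Proof.
case: n => [n|[|n]]; first by rewrite -PoszD addn1.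
  by rewrite /= gK.
have -> : Negz n.+1 + 1 = Negz n by rewrite !NegzE -[n.+2]addn1 PoszD opprD subrK.
by rewrite /= gK.
Qed.

Lemma zpow_pred n x : zpow (n - 1) x = g (zpow n x).
Proof. by rewrite -{2}[n](subrK 1) zpow_succ fK. Qed.

Lemma zpowD m n x : zpow (m + n) x = zpow m (zpow n x).
Proof.
elim/int_ind: m => [|m IH|m IH]; first by rewrite add0r.
  by rewrite -addn1 PoszD -addrA (addrC 1) addrA !zpow_succ IH.
by rewrite -addn1 PoszD opprD -addrA (addrC (- 1)) addrA !zpow_pred IH.
Qed.

Lemma zpowVK n : cancel (zpow (- n)) (zpow n).
Proof. by move=> x; rewrite -zpowD subrr. Qed.

End IntegerIterates.

Section StarAutPow.
Variables (R : realType) (A : cstarAlgType R) (alpha : star_aut A).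
Local Notation pow := (star_aut_pow alpha).

Lemma star_aut_inv_hom : star_hom (star_aut_inv alpha).
Proof.
have inj := can_inj (star_aut_funK alpha); have h := star_aut_hom alpha.
split=> [a x y|x y|x]; apply: inj.
- by rewrite (star_hom_lin h) !star_aut_invK.
- by rewrite (star_hom_mul h) !star_aut_invK.
- by rewrite (star_hom_star h) !star_aut_invK.
Qed.

Lemma star_aut_pow_zpow n x : pow n x = zpow alpha (star_aut_inv alpha) n x.
Proof. by case: n. Qed.

Lemma star_aut_powD m n x : pow (m + n) x = pow m (pow n x).
Proof.
by rewrite !star_aut_pow_zpow zpowD//; [exact: star_aut_funK|exact: star_aut_invK].
Qed.

Lemma star_aut_powK n : cancel (pow n) (pow (- n)).
Proof. by move=> x; rewrite -star_aut_powD addNr. Qed.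

Lemma star_aut_powVK n : cancel (pow (- n)) (pow n).
Proof. by move=> x; rewrite -star_aut_powD subrr. Qed.

Lemma star_aut_pow_hom n : star_hom (pow n).
Proof.
have it (f : A -> A) m : star_hom f -> star_hom (iter m f).
  by move=> hf; elim: m => [|m IH]; [exact: star_hom_id|exact: star_hom_comp IH hf].
by case: n => m; apply: it; [exact: star_aut_hom|exact: star_aut_inv_hom].
Qed.
End StarAutPow.

Lemma fsum_support (V : nmodType) (T : choiceType) (D : set T) (F : T -> V) :
  finite_set D -> (forall n, ~ D n -> F n = 0) ->
  \sum_(n \in [set: T]) F n = \sum_(n <- finmap.enum_fset (fset_set D)) F n.
Proof.
move=> finD F0; rewrite -fsbig_finite//; apply/esym/fsbig_widen => // n /= [_ nD].
exact: F0.
Qed.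

Lemma fsum_single (V : nmodType) (T : choiceType) (a : T) (F : T -> V) :
  (forall n, n <> a -> F n = 0) -> \sum_(n \in [set: T]) F n = F a.
Proof.
move=> F0; have <- : \sum_(n \in [set a]) F n = F a by exact: fsbig_set1.
apply/esym/fsbig_widen => // n /= [_ na].
exact: F0.
Qed.

Lemma fsum_lin (R : realType) (V : lmodType R[i]) (T : choiceType) (F G : T -> V) (a : R[i]) :
  finite_set [set n | F n != 0] -> finite_set [set n | G n != 0] ->
  \sum_(n \in [set: T]) (a *: F n + G n) =
  a *: (\sum_(n \in [set: T]) F n) + \sum_(n \in [set: T]) G n.
Proof.
move=> finF finG; pose D := [set n | F n != 0] `|` [set n | G n != 0].
have finD : finite_set D by rewrite finite_setU.
have F0 n : ~ D n -> F n = 0 by move=> nD; apply: contrapT => /eqP Fn; apply: nD; left.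
have G0 n : ~ D n -> G n = 0 by move=> nD; apply: contrapT => /eqP Fn; apply: nD; right.
rewrite !(fsum_support finD)//; last by move=> n nD; rewrite F0// G0// scaler0 addr0.
by rewrite scaler_sumr -big_split.
Qed.

Section CcAlgebra.
Variables (R : realType) (A : cstarAlgType R) (alpha : star_aut A).
Local Notation pow := (star_aut_pow alpha).
Local Notation Cc := (Cc A).

Lemma Cc_eq (f g : Cc) : (forall n, sval f n = sval g n) -> f = g.
Proof.
case: f g => [f pf] [g pg] /= /funext fg; move: pf pg; rewrite fg => pf pg.
by congr exist; exact: Prop_irrelevance.
Qed.

Lemma single_subproof (n : int) (a : A) :
  finitely_supported (fun m => if m == n then a else 0).
Proof.
apply: sub_finite_set (finite_set1 n) => m /=.
by case: (m =P n) => // _; rewrite eqxx.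
Qed.

Definition single n a : Cc := exist (@finitely_supported R A) _ (single_subproof n a).

Lemma single_lin n z a c : single n (z *: a + c) = Cc_lin z (single n a) (single n c).
Proof. by apply: Cc_eq => m /=; case: eqP => // _; rewrite scaler0 addr0. Qed.

(** Functions supported at one point span, which reduces bilinear identities to
    monomials. *)
Lemma Cc_ind (P : Cc -> Prop) :
  (forall n a, P (single n a)) -> (forall z f g, P f -> P g -> P (Cc_lin z f g)) ->
  forall f, P f.
Proof.
move=> Ps Pl f.
have fin (r : seq int) : finitely_supported (fun m => if m \in r then sval f m else 0).
  apply: sub_finite_set (svalP f) => m /=.
  by case: ifP => // _; rewrite eqxx.
have Pr (r : seq int) : P (exist (@finitely_supported R A) _ (fin r)).
  elim: r => [|n r IH].
    suff <- : single 0 0 = exist (@finitely_supported R A) _ (fin [::]) by exact: Ps.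
    by apply: Cc_eq => m /=; case: ifP.
  suff <- : Cc_lin 1 (single n (if n \in r then 0 else sval f n))
      (exist (@finitely_supported R A) _ (fin r)) =
      exist (@finitely_supported R A) _ (fin (n :: r)) by exact: Pl.
  apply: Cc_eq => m /=; rewrite inE scale1r; case: (m =P n) => [->|_] /=.
    by case: ifP; rewrite ?add0r ?addr0.
  by rewrite add0r.
suff <- : exist (@finitely_supported R A) _ (fin (finmap.enum_fset (fset_set [set n | sval f n != 0]))) = f.
  exact: Pr.
apply: Cc_eq => m /=; rewrite in_fset_set; last exact: (svalP f).
case: ifPn => //; rewrite notin_setE /= => h; apply/esym/eqP.
by apply: contrapT => /negP.
Qed.

Lemma Cc_mul_lin z (f g h : Cc) :
  Cc_mul alpha (Cc_lin z f g) h = Cc_lin z (Cc_mul alpha f h) (Cc_mul alpha g h).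
Proof.
apply: Cc_eq => n /=; rewrite -fsum_lin.
- by apply: eq_fsbigr => m _; rewrite cmulDl cmulZl.
- apply: sub_finite_set (svalP f) => m /=; apply: contraNN => /eqP ->.
  by rewrite cmul0x.
- apply: sub_finite_set (svalP g) => m /=; apply: contraNN => /eqP ->.
  by rewrite cmul0x.
Qed.

Lemma Cc_mulr_lin z (f g h : Cc) :
  Cc_mul alpha h (Cc_lin z f g) = Cc_lin z (Cc_mul alpha h f) (Cc_mul alpha h g).
Proof.
apply: Cc_eq => n /=; rewrite -fsum_lin.
- by apply: eq_fsbigr => m _; rewrite (star_hom_lin (star_aut_pow_hom alpha m)) cmulDr cmulZr.
- apply: sub_finite_set (svalP h) => m /=; apply: contraNN => /eqP ->.
  by rewrite cmul0x.
- apply: sub_finite_set (svalP h) => m /=; apply: contraNN => /eqP ->.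
  by rewrite cmul0x.
Qed.

Lemma Cc_star_lin z (f g : Cc) :
  Cc_star alpha (Cc_lin z f g) = Cc_lin ((z^*)%R) (Cc_star alpha f) (Cc_star alpha g).
Proof.
by apply: Cc_eq => n /=; rewrite cstarD cstarZ (star_hom_lin (star_aut_pow_hom alpha n)).
Qed.

Lemma single_mul m n a c :
  Cc_mul alpha (single m a) (single n c) = single (m + n) (a ** pow m c).
Proof.
apply: Cc_eq => l /=; rewrite (fsum_single (a := m)).
  rewrite eqxx subr_eq [n + m]addrC; case: ifP => // _.
  by rewrite star_aut_pow0 cmulx0.
by move=> k /eqP/negPf ->; rewrite cmul0x.
Qed.

Lemma single_star n a : Cc_star alpha (single n a) = single (- n) (pow (- n) (cstar a)).
Proof.
apply: Cc_eq => m /=; rewrite eqr_oppLR; case: (m =P - n) => [->//|_].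
by rewrite cstar0 star_aut_pow0.
Qed.

End CcAlgebra.

(** A homomorphism pi together with a unitary right multiplier f implementing
    alpha, x U pi(c) = x pi(alpha c) U, integrates to the convolution algebra. *)

Section CovariantPair.
Variables (R : realType) (A B : cstarAlgType R) (alpha : star_aut A).
Variables (pi : A -> B) (f g : B -> B).
Hypothesis pi_hom : star_hom pi.
Hypothesis ru : right_unitary f g.
Hypothesis cov : forall x c, f x ** pi c = f (x ** pi (alpha c)).
Local Notation pow := (star_aut_pow alpha).
Local Notation U := (zpow f g).

Lemma cov_inv x c : g x ** pi c = g (x ** pi (star_aut_inv alpha c)).
Proof.
rewrite -[in RHS](ru_VK ru x) cov (ru_K ru).
by rewrite star_aut_invK.
Qed.

Lemma unitary_cov n x c : U n x ** pi c = U n (x ** pi (pow n c)).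
Proof.
have itf m y d : iter m f y ** pi d = iter m f (y ** pi (iter m alpha d)).
  elim: m y d => [//|m IH] y d; rewrite [iter m.+1 f y]iterS cov IH.
  by rewrite -(iterSr m alpha d).
have itg m y d : iter m g y ** pi d = iter m g (y ** pi (iter m (star_aut_inv alpha) d)).
  elim: m y d => [//|m IH] y d; rewrite [iter m.+1 g y]iterS cov_inv IH.
  by rewrite -(iterSr m (star_aut_inv alpha) d).
by case: n => m; [exact: itf|exact: itg].
Qed.

Lemma unitary_lmm n : left_module_map (U n).
Proof. by case: n => m; apply: lmm_iter; [exact: ru_lmm ru|exact: ru_lmm_inv ru]. Qed.

Lemma unitary_inner n x y : U n x ** cstar (U n y) = x ** cstar y.
Proof.
have gi u v : g u ** cstar (g v) = u ** cstar v.
  by rewrite -(ru_inner ru) !(ru_VK ru).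
case: n => m /=; first by elim: m => //= m IH; rewrite (ru_inner ru).
by elim: m => /= [|m IH]; rewrite gi.
Qed.

Lemma unitary_powD m n x : U (m + n) x = U m (U n x).
Proof. exact: zpowD (ru_K ru) (ru_VK ru) m n x. Qed.

(** The adjoint of pi(c) U^n is U^-n pi(d) with d the adjoint of c; both
    have the same product with every w = w' U^n on the left. *)
Lemma unitary_star n c : cstar (U n (pi c)) = U (- n) (pi (pow (- n) (cstar c))).
Proof.
apply/eqP; rewrite -subr_eq0; apply/eqP/mul_eq0_all => w.
rewrite cmulBr -(lmm_mul (unitary_lmm _)) -unitary_cov (star_hom_star pi_hom).
by rewrite -[in X in X - _](zpowVK (ru_K ru) (ru_VK ru) n w) unitary_inner subrr.
Qed.

Definition integrated (x : Cc A) : B := \sum_(n \in [set: int]) U n (pi (sval x n)).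

Lemma unitary_pi0 n : U n (pi 0) = 0.
Proof. by rewrite (star_hom0 pi_hom); have := lmmZ (unitary_lmm n) 0 0; rewrite !scale0r. Qed.

Lemma integrated_single n a : integrated (single n a) = U n (pi a).
Proof.
rewrite /integrated (fsum_single (a := n)) /= ?eqxx// => m /eqP/negPf ->.
exact: unitary_pi0.
Qed.

Lemma integrated_lin z x y : integrated (Cc_lin z x y) = z *: integrated x + integrated y.
Proof.
rewrite /integrated -fsum_lin.
- by apply: eq_fsbigr => n _; rewrite /= (star_hom_lin pi_hom) (lmm_lin (unitary_lmm n)).
- apply: sub_finite_set (svalP x) => n /=; apply: contraNN => /eqP ->.
  by rewrite unitary_pi0.
- apply: sub_finite_set (svalP y) => n /=; apply: contraNN => /eqP ->.
  by rewrite unitary_pi0.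
Qed.

Lemma integrated_hom : Cc_star_hom alpha integrated.
Proof.
split.
- exact: integrated_lin.
- move=> x y; elim/Cc_ind: x => [m a|z x x' IH IH']; last first.
    by rewrite Cc_mul_lin !integrated_lin IH IH' cmulDl cmulZl.
  elim/Cc_ind: y => [n c|z y y' IH IH']; last first.
    by rewrite Cc_mulr_lin !integrated_lin IH IH' cmulDr cmulZr.
  rewrite single_mul !integrated_single (star_hom_mul pi_hom) -(lmm_mul (unitary_lmm n)) unitary_cov.
  by rewrite addrC unitary_powD.
- move=> x; elim/Cc_ind: x => [n a|z x y IH IH'].
    by rewrite single_star !integrated_single unitary_star.
  by rewrite Cc_star_lin !integrated_lin IH IH' cstarD cstarZ.
Qed.

End CovariantPair.

(** [crossed_mono n a] is the image of the monomial a u^n. *)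

Section CrossedProductEmbedding.
Variables (R : realType) (A : cstarAlgType R) (alpha : star_aut A).
Variables (C : cstarAlgType R) (j : Cc A -> C).
Hypothesis hj : Cc_star_hom alpha j.
Local Notation pow := (star_aut_pow alpha).

Definition crossed_mono n a : C := j (single n a).
Local Notation J := crossed_mono.

Lemma crossed_mono_lin n z a c : J n (z *: a + c) = z *: J n a + J n c.
Proof. by rewrite /crossed_mono single_lin (Cc_hom_lin hj). Qed.

Lemma crossed_mono_mul m n a c : J m a ** J n c = J (m + n) (a ** pow m c).
Proof. by rewrite /crossed_mono -(Cc_hom_mul hj) single_mul. Qed.

Lemma crossed_mono_star n a : cstar (J n a) = J (- n) (pow (- n) (cstar a)).
Proof. by rewrite /crossed_mono -(Cc_hom_star hj) single_star. Qed.

Lemma crossed_mono0_hom : star_hom (J 0).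
Proof.
by split=> [z a c|a c|a]; rewrite ?crossed_mono_lin ?crossed_mono_mul ?crossed_mono_star ?oppr0 ?addr0.
Qed.

(** (a u^n)(a u^n)^* = a a^*, to which [star_hom_bounded] applies. *)
Lemma crossed_mono_bounded n a : nm (J n a) <= 2 * nm a.
Proof.
have := star_hom_bounded crossed_mono0_hom (a ** cstar a).
have -> : J 0 (a ** cstar a) = J n a ** cstar (J n a).
  by rewrite crossed_mono_star crossed_mono_mul subrr star_aut_powVK.
rewrite !nm_mul_star; have := nm_ge0 a; have := nm_ge0 (J n a).
by move: (nm _) (nm _) => t u; nra.
Qed.

Lemma crossed_mono_at0 n : J n 0 = 0.
Proof. by have := crossed_mono_lin n (-1) 0 0; rewrite scaler0 addr0 scaleN1r addNr. Qed.

Lemma crossed_mono_scale n z a : J n (z *: a) = z *: J n a.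
Proof. by rewrite -[z *: a]addr0 crossed_mono_lin crossed_mono_at0 addr0. Qed.

Lemma crossed_mono_lip n a c : nm (J n a - J n c) <= 2 * nm (a - c).
Proof.
have -> : J n a - J n c = J n (a - c); last exact: crossed_mono_bounded.
by have := crossed_mono_lin n (-1) c a; rewrite !scaleN1r addrC => ->; rewrite addrC.
Qed.

End CrossedProductEmbedding.

(** * Representations of the crossed product graph *)

Section CrossedEdges.
Variables (k : nat) (L : kgraph k) (b : kaut L).
Local Notation G := (cpgraph b).
Local Notation up := (lift (@ord_max k)).
Local Notation base := (@base_cube k L b _).
Local Notation prism := (@prism_cube k L b _).

Lemma edge_up (x : Q G 1) i : deg (val x) = basis_deg (up i) ->
  exists2 e : Q L 1, base e = x & deg (val e) = basis_deg i.
Proof.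
have [[e <-]|[v <-]] := cubeP x => /ffunP h.
  exists e => //; apply/ffunP => a; have := h (up a).
  by rewrite cp_degree_up !ffunE (inj_eq lift_inj).
have := h ord_max; rewrite cp_degree_max ffunE.
by have /negPf -> := neq_lift ord_max i.
Qed.

Lemma edge_max (x : Q G 1) : deg (val x) = basis_deg ord_max ->
  exists v : Q L 0, prism v = x.
Proof.
have [[e <-]|[v <-]] := cubeP x => /ffunP h; last by exists v.
by have := h ord_max; rewrite cp_degree_max ffunE eqxx.
Qed.

Lemma src_vertex (v : Q L 0) : src (val v) = val v.
Proof. by have := congr1 val (vsrc_vertex v). Qed.
Lemma rng_vertex (v : Q L 0) : rng (val v) = val v.
Proof. by have := congr1 val (vrng_vertex v). Qed.

Lemma vsrc_base (e : Q L 1) : vsrc (val (base e)) = base (vsrc (val e)).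
Proof. exact: val_inj. Qed.
Lemma vrng_base (e : Q L 1) : vrng (val (base e)) = base (vrng (val e)).
Proof. exact: val_inj. Qed.
Lemma vsrc_prism (v : Q L 0) : vsrc (val (prism v)) = base (cube_aut (kaut_sym b) v).
Proof. by apply: val_inj; rewrite /= /cp_src /= src_vertex. Qed.
Lemma vrng_prism (v : Q L 0) : vrng (val (prism v)) = base v.
Proof. by apply: val_inj; rewrite /= /cp_rng /= rng_vertex. Qed.

Lemma edges_into_base v i : edges_into (base v) (up i) = base @` edges_into v i.
Proof.
apply/seteqP; split=> [x [rx dx]|_ [e [re de] <-]].
  have [e ex de] := edge_up dx; exists e => //; split=> //.
  by move: rx; rewrite -ex => -[].
by split; [rewrite /= /cp_rng /= re|exact: basis_up].
Qed.

Lemma edges_into_prism v : edges_into (base v) ord_max = [set prism v].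
Proof.
apply/seteqP; split=> [x [rx dx]|_ ->].
  have [w wx] := edge_max dx; rewrite -wx /=; congr prism_cube; apply: val_inj.
  by move: rx; rewrite -wx => -[]; rewrite rng_vertex.
by split; [rewrite /= /cp_rng /= rng_vertex|apply: basis_max; exact: deg_vertex].
Qed.

Lemma row_finite_crossed : row_finite_no_sources L -> row_finite_no_sources G.
Proof.
move=> rfL [v m] n dv /=.
have m0 : m = 0%N by rewrite -(cp_degree_max b v m) dv ffunE.
have v0 : deg v = 0 by apply/ffunP => i; rewrite -(cp_degree_up b v m) dv !ffunE.
have [fin [f [rf df]]] := rfL v [ffun i => n (up i)] v0; split.
  apply: sub_finite_set (finite_image (fun f => (f, n ord_max) : G) fin).
  move=> [f' n'] /= [[rf' _] /cp_degree_eq[df' ->]].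
  by exists f'.
by exists (f, n ord_max); split; [rewrite /cp_rng /= rf m0|exact/cp_degree_eq].
Qed.

End CrossedEdges.

Section TwistedCrossedGraph.
Variables (R : realType) (k : nat) (L : kgraph k) (b : kaut L).
Variables (psi : cochain L 2 (circle R)) (chi : cochain L 1 (circle R)).
Local Notation G := (cpgraph b).
Local Notation up := (lift (@ord_max k)).
Local Notation base := (@base_cube k L b _).
Local Notation prism := (@prism_cube k L b _).
Let phi : cochain G 2 (circle R) := cube_case psi chi.

Lemma up_lt (i j : 'I_k) : (up i < up j)%N = (i < j)%N.
Proof. by rewrite !lift_max. Qed.

Section Restriction.
Variables (B : cstarAlgType R) (q : Q G 0 -> B) (t : Q G 1 -> B).
Hypothesis rep : ck_rep phi q t.

Lemma ck_rep_base : ck_rep psi (fun v => q (base v)) (fun e => t (base e)).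
Proof.
split.
- by move=> v; exact: (ck_proj rep).
- by move=> v w vw; apply: (ck_orth rep) => /base_cube_inj.
- by move=> e; rewrite (ck_TG1 rep) vsrc_base.
- move=> i j mu mu' nu nu' x ij dm dm' dn dn' mn nm' mnq nmq.
  rewrite -(cube_case_base b psi chi x).
  apply: (ck_TG2 rep (i := up i) (j := up j)); rewrite ?up_lt//.
  + exact: basis_up.
  + exact: basis_up.
  + exact: basis_up.
  + exact: basis_up.
  + exact/cp_composable.
  + exact/cp_composable.
  + by rewrite /= /cp_comp /= mnq.
  + by rewrite /= /cp_comp /= nmq.
- move=> v i; rewrite /= -/(edges_into v i) => -[e ve].
  have ne : edges_into (base v) (up i) !=set0.
    by exists (base e); rewrite edges_into_base; exists e.
  rewrite (ck_TG3 rep ne) -/(edges_into _ _) edges_into_base fsbig_image//.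
  by move=> x y _ _; exact: base_cube_inj.
Qed.

Lemma prism_src v : cstar (t (prism v)) ** t (prism v) = q (base (cube_aut (kaut_sym b) v)).
Proof. by rewrite (ck_TG1 rep) vsrc_prism. Qed.

Lemma prism_rng v : t (prism v) ** cstar (t (prism v)) = q (base v).
Proof.
have ne : edges_into (base v) ord_max !=set0 by rewrite edges_into_prism; exists (prism v).
by rewrite (ck_TG3 rep ne) -/(edges_into _ _) edges_into_prism fsbig_set1.
Qed.

(** [ck_TG2] on the square (b e, 1), whose two factorizations are
    (b e, 0)(s(b e), 1) and (r(b e), 1)(e, 0). *)
Lemma prism_edge e :
  t (prism (vrng (val (cube_aut b e)))) ** t (base e) =
  val (chi (cube_aut b e)) *: (t (base (cube_aut b e)) ** t (prism (vsrc (val (cube_aut b e))))).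
Proof.
have [i de] := edge_dir e; rewrite -(cube_case_prism b psi chi).
have dbe : deg (b (val e)) = basis_deg i by rewrite kaut_deg.
apply: (ck_TG2 rep (i := up i) (j := ord_max)).
- by rewrite lift_max.
- exact: basis_up.
- exact: basis_up.
- by apply: basis_max; exact: deg_vertex.
- by apply: basis_max; exact: deg_vertex.
- by apply/cp_composable; rewrite /= rng_src.
- by apply/cp_composable; rewrite /= src_rng kaut_rng.
- by rewrite /= /cp_comp /= comp_src.
- by rewrite /= /cp_comp /= comp_rng.
Qed.
End Restriction.

Section IntoCrossedProduct.
Variables (A : cstarAlgType R) (p : Q L 0 -> A) (s : Q L 1 -> A).
Hypothesis rfL : row_finite_no_sources L.
Hypothesis rep : ck_rep psi p s.
Variable beta : star_aut A.
Hypothesis beta_p : forall v, beta (p v) = p (cube_aut b v).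
Hypothesis beta_s : forall e, beta (s e) = val (chi (cube_aut b e)) *: s (cube_aut b e).
Variables (C : cstarAlgType R) (j : Cc A -> C).
Hypothesis hj : Cc_star_hom beta j.
Local Notation J := (crossed_mono j).

Definition crossed_vertex (x : Q G 0) : C := J 0 (p (projT1 (vertexP x))).
Definition crossed_edge : Q G 1 -> C := cube_case (fun e => J 0 (s e)) (fun v => J 1 (p v)).

Lemma crossed_vertex_base v : crossed_vertex (base v) = J 0 (p v).
Proof. by rewrite /crossed_vertex; case: vertexP => w /= /base_cube_inj ->. Qed.
Lemma crossed_edge_base e : crossed_edge (base e) = J 0 (s e).
Proof. exact: cube_case_base. Qed.
Lemma crossed_edge_prism v : crossed_edge (prism v) = J 1 (p v).
Proof. exact: cube_case_prism. Qed.

Lemma beta_inv_p v : star_aut_inv beta (p v) = p (cube_aut (kaut_sym b) v).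
Proof. by rewrite -{1}[v](cube_autVK b) -beta_p star_aut_funK. Qed.

(** In the crossed product u s_e = beta(s_e) u, so that
    (p_(r(b e)) u) s_e = chi(b e) s_(b e) (p_(s(b e)) u): this is [ck_TG2]
    for the squares with an edge in the new direction. *)
Lemma crossed_rep : ck_rep phi crossed_vertex crossed_edge.
Proof.
have hJ := crossed_mono0_hom hj; have repJ := ck_rep_hom rfL rep hJ; split.
- move=> x; have [v <-] := vertexP x; rewrite crossed_vertex_base.
  exact: (ck_proj repJ v).
- move=> x y; have [v <-] := vertexP x; have [w <-] := vertexP y => vw.
  rewrite !crossed_vertex_base; apply: (ck_orth repJ) => vw'; apply: vw.
  by rewrite vw'.
- move=> x; have [[e <-]|[v <-]] := cubeP x.
    rewrite crossed_edge_base vsrc_base crossed_vertex_base.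
    exact: (ck_TG1 repJ e).
  rewrite crossed_edge_prism vsrc_prism crossed_vertex_base.
  rewrite (crossed_mono_star hj) (crossed_mono_mul hj) addNr (ck_proj rep v).2 /= beta_inv_p.
  by rewrite (ck_proj rep _).1.
- move=> i l mu mu' nu nu' x il dm dm' dn dn' mn nm mnx nmx.
  have [i' iE] : exists i', i = up i'.
    case: (unliftP ord_max i) => [i' ->|iE]; first by exists i'.
    by move: il; rewrite iE ltnNge -ltnS ltn_ord.
  rewrite {}iE in il dm dm'.
  have [e eE de] := edge_up dm; have [e' eE' de'] := edge_up dm'.
  case: (unliftP ord_max l) => [l' lE|lE]; rewrite {}lE in il dn dn'.
    have [g gE dg] := edge_up dn; have [g' gE' dg'] := edge_up dn'.
    move: mn nm mnx nmx; rewrite -eE -eE' -gE -gE' => /cp_composable/= mn /cp_composable/= nm.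
    have [[y <-]|[y <-]] := cubeP x => -[mnx] -[nmx] //.
    rewrite !crossed_edge_base /phi cube_case_base; rewrite up_lt in il.
    exact: (ck_TG2 repJ il de de' dg dg' mn nm mnx nmx).
  have [v vE] := edge_max dn; have [v' vE'] := edge_max dn'.
  move: mn nm mnx nmx; rewrite -eE -eE' -vE -vE' => /cp_composable/= mn /cp_composable/= nm.
  have [[y <-]|[y <-]] := cubeP x => -[mnx] -[nmx] //.
  have {}mnx : e = y.
    by apply: val_inj; rewrite /= -mnx -[X in kcomp _ X]rng_vertex -mn comp_src.
  have {}nmx : cube_aut b e' = y.
    by apply: val_inj; rewrite /= -nmx -[X in kcomp X _]src_vertex nm comp_rng.
  have vs : v = vsrc (val y).
    by apply: val_inj; rewrite /= -mnx mn rng_vertex.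
  have vr : v' = vrng (val y).
    by apply: val_inj; rewrite /= -nmx /= -nm src_vertex.
  rewrite !crossed_edge_base !crossed_edge_prism !(crossed_mono_mul hj) /phi cube_case_prism /=.
  rewrite beta_s nmx mnx vs vr (ck_src rep) cmulZr (ck_rng rfL rep) addr0 add0r.
  exact: (crossed_mono_scale hj).
- move=> x; have [v <-] := vertexP x => i; rewrite crossed_vertex_base.
  case: (unliftP ord_max i) => [i' ->|->] edges.
    rewrite /edges -/(edges_into (base v) (up i')) edges_into_base => -[_ [e ve _]].
    have := ck_TG3 repJ (v := v) (i := i') (ex_intro _ e ve).
    rewrite /= -/(edges_into _ _) => ->.
    rewrite fsbig_image; last by move=> y z _ _; exact: base_cube_inj.
    by apply: eq_fsbigr => y _; rewrite crossed_edge_base.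
  rewrite /edges -/(edges_into (base v) ord_max) edges_into_prism fsbig_set1.
  rewrite crossed_edge_prism => _.
  rewrite (crossed_mono_star hj) (crossed_mono_mul hj) subrr (ck_proj rep v).2 star_aut_powVK.
  by rewrite (ck_proj rep v).1.
Qed.
End IntoCrossedProduct.
End TwistedCrossedGraph.

(** * The isomorphism *)

Section TwistedCrossedProduct.
Variables (R : realType) (k : nat) (L : kgraph k) (b : kaut L).
Variables (psi : cochain L 2 (circle R)) (chi : cochain L 1 (circle R)).
Local Notation G := (cpgraph b).
Local Notation base := (@base_cube k L b _).
Local Notation prism := (@prism_cube k L b _).
Let phi : cochain G 2 (circle R) := cube_case psi chi.
Hypothesis rfL : row_finite_no_sources L.
Variables (A : cstarAlgType R) (p : Q L 0 -> A) (s : Q L 1 -> A).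
Hypothesis twA : is_twisted_algebra psi p s.
Variable beta : star_aut A.
Hypothesis beta_p : forall v, beta (p v) = p (cube_aut b v).
Hypothesis beta_s : forall e, beta (s e) = val (chi (cube_aut b e)) *: s (cube_aut b e).
Variables (B : cstarAlgType R) (q : Q G 0 -> B) (t : Q G 1 -> B).
Hypothesis twB : is_twisted_algebra phi q t.

Let repA := twisted_rep twA.
Let repB := twisted_rep twB.
Let rfG := row_finite_crossed (b := b) rfL.

Lemma base_left_ideal_full (S : set B) : closed S ->
  (forall (a : R[i]) x y, S x -> S y -> S (a *: x + y)) ->
  (forall x y, S y -> S (x ** y)) -> (forall v, S (q (base v))) -> forall x, S x.
Proof.
move=> clS linS idS Sq; apply: (left_ideal_full rfG repB twB) => // x.
by have [v <-] := vertexP x.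
Qed.

Lemma prism_unitary_exists : exists f g : B -> B,
  right_unitary f g /\ forall v, f (q (base v)) = t (prism v).
Proof.
apply: (@right_unitary_exists _ _ _ (fun v => q (base v)) (fun v => t (prism v))
  (cube_aut (kaut_sym b) (r := 0)) (cube_aut b (r := 0))).
- by move=> v; exact: (ck_proj repB).
- by move=> v w vw; apply: (ck_orth repB) => /base_cube_inj.
- exact: base_left_ideal_full.
- exact: cube_autVK.
- exact: cube_autK.
- exact: (prism_src repB).
- exact: (prism_rng repB).
Qed.

Variable pi : A -> B.
Hypothesis pi_hom : star_hom pi.
Hypothesis pi_p : forall v, pi (p v) = q (base v).
Hypothesis pi_s : forall e, pi (s e) = t (base e).
Variables f g : B -> B.
Hypothesis ru : right_unitary f g.
Hypothesis f_q : forall v, f (q (base v)) = t (prism v).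

Lemma prism_srcE v : t (prism v) ** q (base (cube_aut (kaut_sym b) v)) = t (prism v).
Proof. by rewrite -vsrc_prism (ck_src repB). Qed.
Lemma prism_rngE v : q (base v) ** t (prism v) = t (prism v).
Proof. by rewrite -vrng_prism (ck_rng rfG repB). Qed.
Lemma base_srcE e : t (base e) ** q (base (vsrc (val e))) = t (base e).
Proof. by rewrite -vsrc_base (ck_src repB). Qed.
Lemma base_rngE e : q (base (vrng (val e))) ** t (base e) = t (base e).
Proof. by rewrite -vrng_base (ck_rng rfG repB). Qed.

Lemma f_prism_base_src e : f (t (base e)) = t (base e) ** t (prism (vsrc (val e))).
Proof. by rewrite -{1}base_srcE (lmm_mul (ru_lmm ru)) f_q. Qed.

Lemma prism_q u v : t (prism u) ** q (base v) = q (base u) ** t (prism (cube_aut b v)).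
Proof.
have [->|/eqP uv] := eqVneq u (cube_aut b v).
  by have := prism_srcE (cube_aut b v); rewrite cube_autK prism_rngE.
rewrite -prism_srcE -cmulA (ck_orth repB) ?cmulx0.
  by rewrite -(prism_rngE (cube_aut b v)) cmulA (ck_orth repB) ?cmul0x// => /base_cube_inj.
by move=> /base_cube_inj uv'; apply: uv; rewrite -uv' cube_autVK.
Qed.

(** The set of such c is a closed self-adjoint subalgebra, so it suffices to
    treat generators, and there x may be taken among the q_v since both sides
    are left module maps in x.  For closure under adjoints, the difference of
    the two sides is annihilated by right multiplication by every (f w)^*. *)
Lemma covariance x c : f x ** pi c = f (x ** pi (beta c)).
Proof.
move: x; suff : [set c | forall x, f x ** pi c = f (x ** pi (beta c))] c by [].
have fl := ru_lmm ru; have hb := star_aut_hom beta.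
rewrite (_ : [set _ | _] = setT)//; apply: (twisted_generated twA); first split.
- have -> : [set c | forall x, f x ** pi c = f (x ** pi (beta c))] =
      \bigcap_x [set c | f x ** pi c = f (x ** pi (beta c))].
    by apply/seteqP; split=> [d hd x _|d hd x]; exact: hd.
  apply: closed_bigI => x _; have [K fK] := lmm_bound fl.
  apply: (@closed_eq_lip _ _ _ _ _ (nm (f x) * 2) (`|K| * (nm x * 4))) => d d'.
    rewrite -cmulBr; apply: le_trans (nmM _ _) _; rewrite -mulrA ler_wpM2l ?nm_ge0//.
    exact: star_hom_lip.
  rewrite -(lmm_sub fl) -cmulBr -(star_homB pi_hom) -(star_homB hb).
  apply: le_trans (fK _) _; apply: le_trans (ler_wpM2r (nm_ge0 _) (ler_norm K)) _.
  rewrite -mulrA ler_wpM2l//; apply: le_trans (nmM _ _) _.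
  rewrite -mulrA ler_wpM2l ?nm_ge0//.
  have := star_hom_bounded pi_hom (beta (d - d')); have := star_hom_bounded hb (d - d'); lra.
- move=> x; rewrite (star_hom0 hb) (star_hom0 pi_hom) !cmulx0.
  by have := lmmZ fl 0 0; rewrite !scale0r.
- move=> z c1 c2 h1 h2 x.
  rewrite (star_hom_lin hb) !(star_hom_lin pi_hom) !cmulDr !cmulZr h1 h2.
  by rewrite (lmm_lin fl).
- move=> c1 c2 h1 h2 x; rewrite (star_hom_mul hb) !(star_hom_mul pi_hom) !cmulA h1 h2.
  by [].
- move=> c1 h1 x; apply/eqP; rewrite -subr_eq0; apply/eqP/mul_eq0_allr => y.
  rewrite -(cstarK y) -(ru_VK ru (cstar y)); set w := g _.
  rewrite cmulBl (ru_inner ru) (star_hom_star hb) !(star_hom_star pi_hom).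
  by rewrite -!cmulA -!cstarM h1 (ru_inner ru) subrr.
- move=> v x; rewrite pi_p beta_p pi_p (lmm_mul fl) f_q.
  apply: (lmm_ext base_left_ideal_full (f := fun x => f x ** q (base v))
    (g := fun x => x ** t (prism (cube_aut b v)))) => [||u].
  + exact: lmm_comp (lmm_mulr _) fl.
  + exact: lmm_mulr.
  + by rewrite f_q prism_q.
- move=> e x; rewrite pi_s beta_s (star_homZ pi_hom) pi_s cmulZr (lmmZ fl) (lmm_mul fl).
  rewrite f_prism_base_src -cmulZr -(prism_edge repB).
  apply: (lmm_ext base_left_ideal_full (f := fun x => f x ** t (base e))
    (g := fun x => x ** (t (prism (vrng (val (cube_aut b e)))) ** t (base e)))) => [||u].
  + exact: lmm_comp (lmm_mulr _) fl.
  + exact: lmm_mulr.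
  + have -> : vrng (val (cube_aut b e)) = cube_aut b (vrng (val e)) by exact: vrng_aut.
    by rewrite f_q -{1}(base_rngE e) cmulA prism_q -cmulA.
Qed.

Section Isomorphism.
Variables (C : cstarAlgType R) (j : Cc A -> C).
Hypothesis cp : is_crossed_product beta j.
Let hj := crossed_hom cp.
Variable F : B -> C.
Hypothesis F_hom : star_hom F.
Hypothesis F_q : forall x, F (q x) = crossed_vertex p j x.
Hypothesis F_t : forall x, F (t x) = crossed_edge p s j x.
Local Notation h := (integrated pi f g).

Lemma hom_pi a : F (pi a) = crossed_mono j 0 a.
Proof.
apply: (twisted_ext rfL repA twA (star_hom_comp pi_hom F_hom) (crossed_mono0_hom hj)) => [v|e] /=.
  by rewrite pi_p F_q crossed_vertex_base.
by rewrite pi_s F_t crossed_edge_base.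
Qed.

(** The a for which this holds form a closed left ideal of A.  It contains each
    p_v by induction on n, as pi(p_v) U^(n+1) = t_(v,1) pi(p_(b^-1 v)) U^n. *)
Lemma hom_iter n a : F (iter n f (pi a)) = crossed_mono j n%:Z a.
Proof.
elim: n a => [|n IH]; first exact: hom_pi.
have fl := lmm_iter n.+1 (ru_lmm ru); have [K fK] := lmm_lip fl.
move fnE : (iter n.+1 f) fl fK => fn fl fK.
apply: (left_ideal_full rfL repA twA (S := [set a | F (fn (pi a)) = crossed_mono j n.+1%:Z a])).
- apply: (@closed_eq_lip _ _ _ _ _ (2 * (`|K| * 2)) 2) => d d'; last exact: (crossed_mono_lip hj).
  apply: le_trans (star_hom_lip F_hom _ _) _; rewrite -!mulrA ler_wpM2l//.
  apply: le_trans (fK _ _) _; apply: le_trans (ler_wpM2r (nm_ge0 _) (ler_norm K)) _.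
  by rewrite ler_wpM2l// star_hom_lip.
- move=> z c d hc hd; rewrite /= (star_hom_lin pi_hom) (lmm_lin fl) (star_hom_lin F_hom).
  by rewrite (crossed_mono_lin hj) hc hd.
- move=> c d hd; rewrite /= (star_hom_mul pi_hom) (lmm_mul fl) (star_hom_mul F_hom) hd.
  by rewrite hom_pi (crossed_mono_mul hj) add0r.
- move=> v; rewrite /= -fnE iterSr pi_p f_q -prism_srcE -pi_p.
  rewrite (lmm_mul (lmm_iter n (ru_lmm ru))) (star_hom_mul F_hom) IH F_t.
  rewrite crossed_edge_prism (crossed_mono_mul hj) /= beta_p cube_autVK (ck_proj repA v).1.
  by rewrite -PoszD add1n.
Qed.

Lemma hom_integrated x : F (h x) = j x.
Proof.
have hh := integrated_hom pi_hom ru covariance.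
elim/Cc_ind: x => [n a|z x y IH IH']; last first.
  by rewrite (Cc_hom_lin hh) (star_hom_lin F_hom) IH IH' (Cc_hom_lin hj).
case: n => n; first by rewrite integrated_single//; exact: hom_iter.
(* negative powers are adjoints of positive ones *)
have -> : single (Negz n) a =
    Cc_star beta (single n.+1%:Z (cstar (star_aut_pow beta n.+1%:Z a))).
  by rewrite single_star cstarK star_aut_powK NegzE.
rewrite (Cc_hom_star hh) (star_hom_star F_hom) (Cc_hom_star hj); congr cstar.
by rewrite integrated_single//; exact: hom_iter.
Qed.

Lemma isomorphic_crossed : cstar_isomorphic C B.
Proof.
have hh := integrated_hom pi_hom ru covariance.
have [G' [[G_hom G_j] _]] := crossed_universal cp hh.
exists G' => //; exists F => x.
  have [u [_ uniq]] := crossed_universal cp hj.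
  have e1 : u = id by apply: uniq; split=> //; exact: star_hom_id.
  have e2 : u = F \o G'.
    apply: uniq; split; first exact: star_hom_comp G_hom F_hom.
    by move=> y /=; rewrite G_j hom_integrated.
  by have := congr1 (fun w => w x) e2; rewrite e1 => /= <-.
apply: (twisted_ext rfG repB twB (star_hom_comp F_hom G_hom) (star_hom_id B)) => y /=.
  have [v <-] := vertexP y; rewrite F_q crossed_vertex_base G_j integrated_single//.
  by rewrite /= pi_p.
have [[e <-]|[v <-]] := cubeP y; rewrite F_t.
  by rewrite crossed_edge_base G_j integrated_single//= pi_s.
by rewrite crossed_edge_prism G_j integrated_single//= pi_p f_q.
Qed.
End Isomorphism.
End TwistedCrossedProduct.

Theorem corollary2p4 (R : realType) (k : nat) (L : kgraph k) (b : kaut L)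
    (psi : cochain L 2 (circle R)) :
  row_finite_no_sources L ->
  cocycle psi ->
  cohomology_class psi = cohomology_class (pullback b psi) ->
  exists phi : cochain (cpgraph b) 2 (circle R),
    [/\ cocycle phi, psi = base_restriction phi &
      forall (A : cstarAlgType R) (p : Q L 0 -> A) (s : Q L 1 -> A),
        is_twisted_algebra psi p s ->
        exists beta_phi : star_aut A,
          [/\ forall v : Q L 0, beta_phi (p v) = p (cube_aut b v),
              forall e : Q L 1, beta_phi (s e) =
                val (phi (prism_cube b (cube_aut b e))) *: s (cube_aut b e) &
              forall (C : cstarAlgType R) (j : Cc A -> C)
                  (B : cstarAlgType R) (q : Q (cpgraph b) 0 -> B)
                  (t : Q (cpgraph b) 1 -> B),
                is_crossed_product beta_phi j ->
                is_twisted_algebra phi q t ->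
                cstar_isomorphic C B]].
Proof.
move=> rfL psi0 psi_coh.
have [c psic] : exists c : cochain L 1 (circle R),
    forall x, psi x - psi (cube_aut b x) = delta c x.
  (* psi lies in its own class, hence in the class of its pullback *)
  have : cohomology_class psi psi.
    split=> //; exists (fun _ => 0); apply/funext => x; rewrite subrr /delta big1// => i _.
    by rewrite big1// => l _; rewrite mul0rz.
  by rewrite psi_coh => -[_ [c cE]]; exists c => x; rewrite -cE.
pose chi : cochain L 1 (circle R) := fun e => - c (cube_aut (kaut_sym b) e).
exists (cube_case psi chi); split.
- exact: cocycle_cube_case.
- by apply/funext => x; rewrite /base_restriction cube_case_base.
move=> A p s twA.
have [beta [beta_p beta_s]] := twisted_automorphism rfL psic twA.
have {}beta_s e : beta (s e) = val (chi (cube_aut b e)) *: s (cube_aut b e).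
  by rewrite beta_s /chi cube_autK.
exists beta; split=> // [e|C j B q t cp twB]; first by rewrite cube_case_prism.
have repB := twisted_rep twB.
have [pi [[pi_hom pi_p pi_s] _]] := twisted_universal twA (ck_rep_base repB).
have [f [g [ru f_q]]] := prism_unitary_exists rfL twB.
have crep := crossed_rep rfL (twisted_rep twA) beta_p beta_s (crossed_hom cp).
have [F [[F_hom F_q F_t] _]] := twisted_universal twB crep.
exact: (isomorphic_crossed rfL twA beta_p beta_s twB pi_hom pi_p pi_s ru f_q cp F_hom F_q F_t).
Qed.
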